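(* Let $V$ be a finite nonempty set and let $q: V\times V\to\mathbb{C}$ be an integrable weight (not necessarily Hermitian), with matrix $Q=(q_{uv}:u,v\in V)$. Let $\nu_c$ be the (directed) current field of the loop soup at intensity $1$ induced by $q$. Then for every current $C\in\mathcal{C}_V$, $$\nu_c\{C\}=\det(I-Q)\; q(C)\prod_{u\in V}\frac{n_u(C)!}{\prod_{v\in V}C_{uv}!}.$$
   Context: $\mathbb{N}=\{0,1,2,\dots\}$. $V$ is the vertex set of a finite complete digraph with directed edges $V\times V$ (self-edges allowed). A weight is a function $q:V\times V\to\mathbb{C}$, written $q_{uv}=q(u,v)$, with matrix $Q=(q_{uv})$. It is called integrable if the spectral radius of the matrix of absolute values $|Q|=(|q_{uv}|)$ is strictly less than $1$. Paths and loops. A path of length $|\omega|=k$ in $V$ is a sequence $\omega=(\omega^0,\dots,\omega^k)$ of vertices; its weight is $q(\omega)=\prod_{j=1}^k q_{\omega^{j-1}\omega^j}$ (equal to $1$ if $k=0$). A rooted loop is a path with $\omega^0=\omega^k$; it is nontrivial if $k>0$. The directed edge local time of $\omega$ is the matrix $\boldsymbol{c}(\omega)=(c_{uv}(\omega))_{u,v\in V}$, $c_{uv}(\omega)=\#\{1\le j\le k:\omega^{j-1}=u,\ \omega^j=v\}$. An (oriented) unrooted loop is an equivalence class $l$ of nontrivial rooted loops under cyclic permutations $(\omega^0,\omega^1,\dots,\omega^k=\omega^0)\sim(\omega^1,\dots,\omega^{k-1},\omega^0,\omega^1)\sim\cdots$. The set of unrooted loops is $\mathcal{L}$. For $l\in\mathcal{L}$,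 $q(l)$ and $\boldsymbol{c}(l)$ are defined as $q(\omega)$ and $\boldsymbol{c}(\omega)$ for any representative $\omega\in l$. Currents. A (directed) current is a matrix $C=(C_{uv})_{u,v\in V}$ with entries in $\mathbb{N}$ such that $\sum_{v}C_{uv}=\sum_v C_{vu}$ for all $u\in V$; the set of currents is $\mathcal{C}_V$. For $C\in\mathcal{C}_V$, $q(C)=\prod_{u,v\in V}q_{uv}^{C_{uv}}$ (with $0^0=1$) and $n_u(C)=\frac12\sum_{v\in V}(C_{uv}+C_{vu})=\sum_{v\in V}C_{uv}$. Loop measure and loop soup. The unrooted loop measure is $m(l)=\sum_{\omega\in l}\frac{q(\omega)}{|\omega|}=\frac{q(l)}{d(l)}$, where $d(l)$ is the largest integer $d$ such that every representative of $l$ is a concatenation of $d$ identical loops; for integrable $q$ this is a complex measure on $\mathcal{L}$, with total mass $m(\mathcal{L})=\sum_{l\in\mathcal{L}}m(l)$. Let $\mathbb{N}^{\mathcal{L}}_{\mathrm{fin}}$ be the set of finitely supported functions $\boldsymbol{s}=(s_l)_{l\in\mathcal{L}}:\mathcal{L}\to\mathbb{N}$ (finite multisets of unrooted loops). The loop soup at intensity $1$ is the complex measure on $\mathbb{N}^{\mathcal{L}}_{\mathrm{fin}}$ given by $$\nu_m\{\boldsymbol{s}\}=e^{-m(\mathcal{L})}\prod_{l\in\mathcal{L}}\frac{m(l)^{s_l}}{s_l!}.$$ With $\boldsymbol{c}(\boldsymbol{s})=\sum_{l}s_l\,\boldsymbol{c}(l)$, the (directed) current field is the pushforward of $\nu_m$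 to currents: $\nu_c\{C\}=\sum_{\boldsymbol{s}:\,\boldsymbol{c}(\boldsymbol{s})=C}\nu_m\{\boldsymbol{s}\}$. *)

(* Defs.v *)
From HB Require Import structures.
From mathcomp Require Import all_boot all_order all_algebra.
From mathcomp Require Import finmap generic_quotient complex.
From mathcomp Require Import boolp classical_sets fsbigop reals ereal numfun.
From mathcomp Require Import sequences esum exp trigo.

Set Implicit Arguments.
Unset Strict Implicit.
Unset Printing Implicit Defensive.

Import Order.TTheory GRing.Theory Num.Theory.

Local Open Scope quotient_scope.
Local Open Scope classical_set_scope.
Local Open Scope complex_scope.
Local Open Scope ring_scope.

Definition cexp (R : realType) (z : R[i]) : R[i] :=
  (expR (complex.Re z))%:C * (cos (complex.Im z) +i* sin (complex.Im z)).

(* Sum of an absolutely summable family over an arbitrary index set, i.e. its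
   integral against the counting measure: positive minus negative part, for
   the real and the imaginary parts separately. *)
Definition rsum (R : realType) (T : choiceType) (D : set T) (f : T -> R) : R :=
  fine (esum D (EFin \o f)^\+ - esum D (EFin \o f)^\-)%E.

Definition csum (R : realType) (T : choiceType) (D : set T) (f : T -> R[i]) :
    R[i] :=
  rsum D (fun x => complex.Re (f x)) +i* rsum D (fun x => complex.Im (f x)).

(* The eigenvalues are those of A over the algebraically closed field R[i]. *)
Definition spectral_radius (R : realType) (n : nat) (A : 'M[R[i]]_n) : R :=
  sup [set complex.Re `|a| | a in [set a : R[i] | eigenvalue A a]].

Section Weight.
Variables (R : realType) (V : finType) (q : V -> V -> R[i]).

(* Rows and columns are indexed by V through the enumeration of V. *)
Definition weight_mx : 'M[R[i]]_#|V| :=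
  \matrix_(i, j) q (enum_val i) (enum_val j).

Definition integrable_weight : Prop :=
  spectral_radius (map_mx (fun z => `|z|) weight_mx) < 1.

End Weight.

Section Loops.
Variable V : finType.

(* A path (w^0, ..., w^k) is a sequence of k + 1 vertices. *)
Definition path_length (w : seq V) : nat := (size w).-1.

Definition path_edges (w : seq V) : seq (V * V) := zip w (behead w).

Definition edge_count (w : seq V) (u v : V) : nat :=
  count_mem (u, v) (path_edges w).

Definition path_weight (R : realType) (q : V -> V -> R[i]) (w : seq V) : R[i] :=
  \prod_(e <- path_edges w) q e.1 e.2.

Definition nontrivial_loop (w : seq V) : bool :=
  if w is x :: p then (p != [::]) && (last x p == x) else false.

Definition rooted_loop : Type := {w : seq V | nontrivial_loop w}.

HB.instance Definition _ := Choice.on rooted_loop.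

(* (w^0, w^1, ..., w^k) |-> (w^1, ..., w^k, w^1); here w^k = w^0. *)
Definition loop_shift (w : seq V) : seq V :=
  if w is _ :: y :: p then rcons (y :: p) y else w.

Definition cyclic_eq (w w' : rooted_loop) : bool :=
  `[< exists n, iter n loop_shift (val w) = val w' >].

Lemma iter_loop_shift n x p : p != [::] -> last x p = x ->
  iter n loop_shift (x :: p) = last x (iter n (rot 1) p) :: iter n (rot 1) p.
Proof.
move=> p0 xp.
suff H : iter n loop_shift (x :: p) =
    last x (iter n (rot 1) p) :: iter n (rot 1) p /\ iter n (rot 1) p != [::].
  by case: H.
elim: n => [|n [IH IH0]]; first by rewrite /= xp.
rewrite !iterS IH; case: (iter n _ p) IH0 => // y s _ /=.
by rewrite rot1_cons last_rcons; split=> //; case: s.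
Qed.

Lemma iter_rot1_size (p : seq V) : iter (size p) (rot 1) p = p.
Proof.
have H n : (n <= size p)%N -> iter n (rot 1) p = rot n p.
  elim: n => [|n IH] h; first by rewrite rot0.
  by rewrite iterS IH ?(ltnW h)// -rotD// add1n.
by rewrite H// rot_size.
Qed.

Lemma cyclic_eq_refl : reflexive cyclic_eq.
Proof. by move=> w; apply/asboolP; exists 0%N. Qed.

Lemma cyclic_eq_trans : transitive cyclic_eq.
Proof.
move=> w2 w1 w3 /asboolP[m h1] /asboolP[n h2]; apply/asboolP.
by exists (n + m)%N; rewrite iterD h1.
Qed.

Lemma cyclic_eq_sym : symmetric cyclic_eq.
Proof.
suff H w w' : cyclic_eq w w' -> cyclic_eq w' w.
  by move=> w w'; apply/idP/idP; apply: H.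
move=> /asboolP[n h]; apply/asboolP.
case: w h => -[//|x p] /= /andP[p0 /eqP xp] h.
have per m : iter (m * size p) loop_shift (x :: p) = x :: p.
  rewrite iter_loop_shift//.
  suff -> : iter (m * size p) (rot 1) p = p by rewrite xp.
  by elim: m => [//|m IH]; rewrite mulSn iterD IH iter_rot1_size.
have sp : (0 < size p)%N by case: (p) p0.
exists (n * size p - n)%N.
by rewrite -h -iterD subnK ?per// leq_pmulr.
Qed.

Canonical cyclic_equiv :=
  EquivRel cyclic_eq cyclic_eq_refl cyclic_eq_sym cyclic_eq_trans.

Definition unrooted_loop : Type := {eq_quot cyclic_equiv}%qT.

HB.instance Definition _ := Choice.on unrooted_loop.
HB.instance Definition _ := EqQuotient.on unrooted_loop.

End Loops.

Section LoopSoup.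
Variables (R : realType) (V : finType) (q : V -> V -> R[i]).
Local Notation L := (unrooted_loop V).

Definition loop_members (l : L) : set (rooted_loop V) :=
  [set w | \pi_L w = l]%qT.

(* A finite sum: l has at most |w| members, for w any one of them. *)
Definition loop_measure (l : L) : R[i] :=
  \sum_(w \in loop_members l) path_weight q (val w) / (path_length (val w))%:R.

Definition loop_mass : R[i] := csum [set: L] loop_measure.

(* Independent of the representative, since loop_shift permutes the edges. *)
Definition loop_edge_count (l : L) : V -> V -> nat := edge_count (val (repr l)).

Definition soup : Type := {fsfun L -> nat with 0%N}.

HB.instance Definition _ := Choice.on soup.

(* Outside the support of s the factors of the product over all loops are 1. *)
Definition soup_measure (s : soup) : R[i] :=
  cexp (- loop_mass) *
  \prod_(l <- finsupp s) (loop_measure l ^+ s l / ((s l)`!)%:R).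

Definition soup_current (s : soup) (u v : V) : nat :=
  (\sum_(l <- finsupp s) s l * loop_edge_count l u v)%N.

Definition current_field (C : V -> V -> nat) : R[i] :=
  csum [set s : soup | soup_current s = C] soup_measure.

End LoopSoup.

Section Currents.
Variable V : finType.

Definition is_current (C : V -> V -> nat) : Prop :=
  forall u, (\sum_v C u v = \sum_v C v u)%N.

(* For a current the sum that is halved is even. *)
Definition current_degree (C : V -> V -> nat) (u : V) : nat :=
  ((\sum_v (C u v + C v u))./2)%N.

Definition current_weight (R : realType) (q : V -> V -> R[i])
    (C : V -> V -> nat) : R[i] :=
  \prod_u \prod_v q u v ^+ C u v.

End Currents.

(* Main.v *)
Require Import Defs.
From mathcomp Require Import all_boot all_order all_algebra.
From mathcomp Require Import finmap generic_quotient complex spectral.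
From mathcomp Require Import zify ring lra.
From mathcomp Require Import boolp classical_sets functions cardinality fsbigop.
From mathcomp Require Import reals ereal topology normedtype sequences derive.
From mathcomp Require Import realfun numfun esum exp trigo.

Set Implicit Arguments.
Unset Strict Implicit.
Unset Printing Implicit Defensive.

Import Order.TTheory GRing.Theory Num.Theory numFieldNormedType.Exports.

Local Open Scope complex_scope.
Local Open Scope ring_scope.

(** Write [F C] for the sum of [prod_l m(l)^(s_l) / s_l!] over the soups [s]
    with current [C], which is a finite sum, and [G C] for
    [q(C) prod_u n_u(C)! / prod_v C_uv!]. The two claims are
    [exp(- m(L)) = det(I - Q)] and [F = G].

    For the first, [m(L)] is the sum of [tr(Q^k) / k]: eigenvalues of [|Q|] lie
    in a disc of radius [r < 1], so by Cayley-Hamilton the entries of [|Q|^k],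
    which dominate those of [Q^k], are [O(r^k)], and triangularizing [Q]
    reduces the claim to [exp(- sum_k z^k / k) = 1 - z].

    For the second, removing one loop from a soup gives
    [n_u(C) F(C) = sum_w q(w) F(C - c(w))] over the nontrivial loops [w] rooted
    at [u]: the average over rotations turns [n_u(l) m(l)] into the weight of
    the members of [l] rooted at [u]. The same recursion holds for [G], which
    counts stacks of exits at each vertex: if [C] is a unit flow from [x] to [u],
    the sum of [q(w) G(C - c(w))] over the paths [w] from [x] to [u] is
    [(n_u(C) + 1) G(C)], by Pascal's rule for the multinomials [G] and
    induction on [|C|]. *)

(** * Matrix powers and the spectral radius *)

Section MatrixPowers.
Variable F : numClosedFieldType.
Implicit Type r : F.

(** Induction on [k]: the constant [c] in front of [r ^+ k] satisfies [K + |a| c <= r c], which the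
    gap [r - |a| > 0] makes possible. *)
Lemma affine_recursion_bound (x : nat -> F) a r K :
  `|a| < r -> 0 <= K -> (forall k, `|x k.+1 - a * x k| <= K * r ^+ k) ->
  forall k, `|x k| <= (`|x 0%N| + K / (r - `|a|)) * r ^+ k.
Proof.
move=> ar K0 xK; have ra : 0 < r - `|a| by rewrite subr_gt0.
have r0 : 0 < r by apply: le_lt_trans ar.
elim=> [|k IH]; first by rewrite expr0 mulr1 lerDl divr_ge0// ltW.
rewrite -[x k.+1](subrK (a * x k)) (le_trans (ler_normD _ _))//.
rewrite (le_trans (lerD (xK k) _) (_ : K * r ^+ k +
  `|a| * ((`|x 0%N| + K / (r - `|a|)) * r ^+ k) <= _))//.
  by rewrite normrM ler_wpM2l.
rewrite exprSr !mulrA -mulrDl [leRHS]mulrAC ler_wpM2r//.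
  by rewrite exprn_ge0// ltW.
rewrite -lerBrDr [ `|a| * _]mulrC -mulrBr mulrDl divfK ?gt_eqF//.
by rewrite lerDr mulr_ge0// ltW.
Qed.

(** Induction on the annihilating factors. With [B] general, one factor [A - a] moves onto [B]; then
    [A ^+ k * B] follows a recursion of multiplier [a] whose error [A ^+ k * ((A - a) * B)] is
    [O(r^k)] by induction. *)
Lemma pow_mulmx_bound n (A B : 'M[F]_n.+1) r (s : seq F) :
  0 < r -> {in s, forall a, `|a| < r} ->
  (\prod_(a <- s) (A - a%:M)) * B = 0 ->
  exists2 K, 0 <= K & forall k i j, `|(A ^+ k * B) i j| <= K * r ^+ k.
Proof.
move=> r0; elim: s B => [|a s IH] B sr.
  rewrite big_nil mul1r => ->; exists 0 => // k i j.
  by rewrite mulr0 mxE normr0 mul0r.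
rewrite big_cons => AB.
have ar : `|a| < r by apply: sr; rewrite mem_head.
have comm t : GRing.comm (A - a%:M) (\prod_(a <- t) (A - a%:M)).
  apply: commr_prod => b _.
  have cA c (M : 'M[F]_n.+1) : GRing.comm M c%:M by exact: comm_mx_scalar.
  apply: commrB; last exact: cA.
  by apply/commr_sym/commrB; [|exact: cA].
have [||K K0 AK] := IH ((A - a%:M) * B).
- by move=> b sb; apply: sr; rewrite inE sb orbT.
- by rewrite mulrA -comm.
(* Summing the nonnegative bounds of all entries gives one constant valid for every [i] and [j]. *)
pose K' := \sum_i \sum_j (`|(A ^+ 0 * B) i j| + K / (r - `|a|)).
have term i j : 0 <= `|(A ^+ 0 * B) i j| + K / (r - `|a|).
  by rewrite addr_ge0// divr_ge0// subr_ge0 ltW.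
exists K'; first by rewrite sumr_ge0// => i _; rewrite sumr_ge0.
move=> k i j.
have H := @affine_recursion_bound (fun k => (A ^+ k * B) i j) a r K ar K0.
rewrite (le_trans (H _ k)) ?ler_wpM2r ?exprn_ge0 ?(ltW r0)//=.
  move=> {}k; have -> : (A ^+ k.+1 * B) i j - a * (A ^+ k * B) i j =
      (A ^+ k * ((A - a%:M) * B)) i j.
    rewrite mulrBl mulrBr mulrA -exprSr !mxE; congr (_ - _).
    rewrite mulr_sumr; apply: eq_bigr => l _; rewrite mulrCA; congr (_ * _).
    by rewrite -[_ * B]/(a%:M *m B) mul_scalar_mx mxE.
  exact: AK.
rewrite /K' (bigD1 i)//= (bigD1 j)//= -addrA lerDl addr_ge0 ?sumr_ge0// => l _.
by rewrite sumr_ge0.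
Qed.

Lemma mx_pow_bound n (A : 'M[F]_n.+1) r :
  0 < r -> (forall a, eigenvalue A a -> `|a| < r) ->
  exists2 K, 0 <= K & forall k i j, `|(A ^+ k) i j| <= K * r ^+ k.
Proof.
move=> r0 Ar.
have [s ps] := closed_field_poly_normal (char_poly A).
rewrite (monicP (char_poly_monic A)) scale1r in ps.
have [|//||K K0 AK] := @pow_mulmx_bound n A 1 r s.
- by [].
- by move=> a sa; apply: Ar; rewrite eigenvalue_root_char ps root_prod_XsubC.
- rewrite mulr1 -[RHS](Cayley_Hamilton A) ps rmorph_prod/=.
  by apply: eq_bigr => a _; rewrite rmorphB/= horner_mx_X horner_mx_C.
by exists K => // k i j; rewrite -[A ^+ k]mulr1.
Qed.
End MatrixPowers.

(** * Trace and determinant through triangularization *)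

Section Triangular.
Variable F : comNzRingType.

Lemma mulmx_trig n (A B : 'M[F]_n) :
  is_trig_mx A -> is_trig_mx B -> is_trig_mx (A *m B).
Proof.
move=> /is_trig_mxP At /is_trig_mxP Bt; apply/is_trig_mxP => i j ij.
rewrite mxE big1// => k _; case: (ltnP i k) => ik; first by rewrite At ?mul0r.
by rewrite Bt ?mulr0// (leq_ltn_trans ik).
Qed.

Lemma mulmx_trig_diag n (A B : 'M[F]_n) i :
  is_trig_mx A -> is_trig_mx B -> (A *m B) i i = A i i * B i i.
Proof.
move=> /is_trig_mxP At /is_trig_mxP Bt.
rewrite mxE (bigD1 i)//= big1 ?addr0// => k /negP ki.
case: (ltngtP i k) => ik; first by rewrite At ?mul0r.
  by rewrite Bt ?mulr0.
by case: ki; apply/eqP/val_inj.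
Qed.

Lemma expmx_trig n (A : 'M[F]_n.+1) k : is_trig_mx A ->
  is_trig_mx (A ^+ k) /\ forall i, (A ^+ k) i i = A i i ^+ k.
Proof.
move=> At; elim: k => [|k [IHt IH]].
  rewrite expr0; split=> [|i]; first exact: scalar_mx_is_trig.
  by rewrite mxE eqxx.
rewrite exprS -[A * _]/(A *m A ^+ k); split=> [|i]; first exact: mulmx_trig.
by rewrite mulmx_trig_diag// IH exprS.
Qed.

End Triangular.

(** [l] is the diagonal of a Schur form of [A]: conjugation preserves eigenvalues, traces and
    determinants, and powers of a triangular matrix carry the powers of its diagonal. *)
Lemma spectrum_trace_det (F : numClosedFieldType) n (A : 'M[F]_n.+1) :
  exists l : 'I_n.+1 -> F, [/\ forall i, eigenvalue A (l i),
    forall k, \tr (A ^+ k) = \sum_i l i ^+ k &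
    \det (1%:M - A) = \prod_i (1 - l i)].
Proof.
have [//|P /unitarymx_unit uP trigT] := Schur A.
pose T := conjmx P A.
have Tt : is_trig_mx T by exact: trigT.
have TE : T = P *m A *m invmx P by rewrite /T conjumx.
exists (fun i => T i i); split=> [i|k|].
- apply: (@eigenvalue_conjmx _ _ _ P).
  + by rewrite stablemx_unit.
  + by rewrite row_free_unit.
  rewrite [_ \in _]eigenvalue_root_char char_poly_trig// rootE horner_prod.
  by rewrite (bigD1 i)//= hornerXsubC subrr mul0r.
- have -> : A ^+ k = invmx P *m T ^+ k *m P.
    have AE : A = invmx P *m T *m P.
      by rewrite TE !mulmxA mulVmx// mul1mx -!mulmxA mulVmx// mulmx1.
    elim: k => [|k IH]; first by rewrite !expr0 -idmxE mulmx1 mulVmx.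
    rewrite !exprS -!mulmxE {1}AE IH !mulmxA; congr (_ *m _ *m _).
    by rewrite -!mulmxA mulmxV// mulmx1.
  rewrite mxtrace_mulC mulmxA mulmxV// mul1mx /mxtrace.
  by apply: eq_bigr => i _; rewrite (expmx_trig k Tt).2.
- clearbody T; have -> : \det (1%:M - A) = \det (1%:M - T).
    have -> : 1%:M - T = P *m (1%:M - A) *m invmx P.
      by rewrite mulmxBr mulmxBl mulmx1 mulmxV// TE.
    by rewrite !det_mulmx mulrAC -det_mulmx mulmxV// det1 mul1r.
  have Tt1 : is_trig_mx (1%:M - T).
    apply/is_trig_mxP => i j ij; have /is_trig_mxP Tt' := Tt.
    by rewrite !mxE Tt'// subr0 -val_eqE/= ltn_eqF.
  by rewrite det_trig//; apply: eq_bigr => i _; rewrite !mxE eqxx.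
Qed.

Lemma expmx_norm_le (F : numDomainType) n (A : 'M[F]_n.+1) k i j :
  `|(A ^+ k) i j| <= (map_mx Num.norm A ^+ k) i j.
Proof.
elim: k i j => [|k IH] i j; first by rewrite !expr0 !mxE normr_nat.
rewrite !exprS !mxE (le_trans (ler_norm_sum _ _ _))// ler_sum// => l _.
by rewrite normrM mxE ler_wpM2l.
Qed.

Lemma le0_of_le_geometric (R : realType) (c K r : R) : 0 <= r < 1 ->
  (forall k, c <= K * r ^+ k) -> c <= 0.
Proof.
move=> /andP[r0 r1] cK.
have h : ((fun k => K * r ^+ k) @ \oo --> (0 : R))%classic.
  rewrite -[0](mulr0 K); apply: cvgM; first exact: cvg_cst.
  by apply: cvg_expr; rewrite ger0_norm.
by apply: (cvgr_to_ge h); apply: nearW.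
Qed.

(** * Consequences of a spectral radius below one *)

Section Complex.
Variable R : realType.
Local Notation C := R[i].

Lemma normCE (z : C) : `|z| = (complex.Re `|z|)%:C.
Proof. by rewrite RRe_real ?normr_real. Qed.

Lemma spectral_radius_gap n (A : 'M[C]_n) : spectral_radius A < 1 ->
  exists2 r : R, 0 < r < 1 & forall a, eigenvalue A a -> `|a| < r%:C.
Proof.
rewrite /spectral_radius; set S := (X in sup X) => rho1.
have [s ps] := closed_field_poly_normal (char_poly A).
rewrite (monicP (char_poly_monic A)) scale1r in ps.
(* The supremum bounds [S] only if [S] is bounded; the eigenvalues are among finitely many roots, so
   the sum of the moduli of these is a bound. *)
have ubS : has_ubound S.
  exists (\sum_(a <- s) complex.Re `|a|) => _ [a /= Aa <-].
  move: Aa; rewrite eigenvalue_root_char ps root_prod_XsubC => sa.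
  rewrite (big_rem a)//= lerDl sumr_ge0// => b _.
  by rewrite -lecR -normCE; exact: normr_ge0.
pose r := Num.max 0 (sup S); have r0 : 0 <= r by rewrite le_max lexx.
have r1 : r < 1 by rewrite gt_max ltr01.
(* The midpoint of [r] and 1 is positive and makes the inequality strict. *)
exists ((r + 1) / 2); first by apply/andP; split; lra.
move=> a Aa; rewrite normCE ltcR.
apply: (@le_lt_trans _ _ r); last lra.
by rewrite le_max; apply/orP; right; apply: ub_le_sup => //; exists a.
Qed.

Lemma dominated_pow_bound n (A : 'M[C]_n.+1) :
  spectral_radius (map_mx Num.norm A) < 1 ->
  exists r K : R, [/\ 0 < r < 1, 0 <= K &
  forall k i j, (map_mx Num.norm A ^+ k) i j <= (K * r ^+ k)%:C].
Proof.
move=> /spectral_radius_gap[r r01 Ar].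
have [|K K0 AK] := @mx_pow_bound _ n (map_mx Num.norm A) r%:C _ Ar.
  by rewrite ltcR; case/andP: r01.
(* [K] is a nonnegative element of [R[i]], hence real. *)
exists r, (complex.Re K); split=> // [|k i j].
  by rewrite -lecR RRe_real ?ger0_real.
rewrite rmorphM rmorphXn/= RRe_real ?ger0_real//.
apply: le_trans (AK k i j); rewrite ger0_norm//.
exact: le_trans (normr_ge0 _) (expmx_norm_le _ _ _ _).
Qed.

(** For a row eigenvector [v] with [|a| >= 1], [|v_j| <= |(v A^k)_j| <= sum_i |v_i| (|A|^k)_ij],
    which is [O(r^k)]; letting [k] grow forces [v = 0]. *)
Lemma dominated_eigenvalue_lt1 n (A : 'M[C]_n.+1) a :
  spectral_radius (map_mx Num.norm A) < 1 -> eigenvalue A a -> `|a| < 1.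
Proof.
move=> /dominated_pow_bound[r [K [/andP[r0 r1] K0 AK]]].
move=> /eigenvalueP[v va v0]; rewrite real_ltNge ?normr_real//.
apply/negP => a1; case/negP: v0; apply/eqP/rowP => j; rewrite [RHS]mxE.
have vk k : v *m A ^+ k = a ^+ k *: v.
  elim: k => [|k IH]; first by rewrite !expr0 mulmx1 scale1r.
  by rewrite exprSr -mulmxE mulmxA IH -scalemxAl va scalerA exprSr.
pose S := \sum_i complex.Re `|v 0 i|.
apply/normr0_eq0/le_anti; rewrite normr_ge0 andbT normCE lecR.
apply: (@le0_of_le_geometric _ _ (S * K) r); first by rewrite ltW.
move=> k; rewrite -lecR -normCE.
apply: (@le_trans _ _ `|(v *m A ^+ k) 0 j|).
  by rewrite vk mxE normrM normrX ler_peMl// exprn_ege1.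
rewrite mxE (le_trans (ler_norm_sum _ _ _))//.
rewrite -mulrA rmorphM rmorph_sum/= mulr_suml ler_sum// => i _.
rewrite normrM -normCE ler_wpM2l// (le_trans (expmx_norm_le _ _ _ _))//.
Qed.

End Complex.

(** * The logarithm series *)

Section GeometricPseries.
Local Open Scope classical_set_scope.
Local Open Scope ring_scope.
Variable R : realType.
Implicit Types (f : nat -> R) (K : R).

(** For positive [K], coefficients [O(r^k)] with [r < 1 / K]. Unlike mere convergence of the power
    series at [K], this passes to the termwise derivative with the same [K]. *)
Definition geometrically_bounded f K :=
  exists M r, [/\ 0 <= M, 0 < r, r * K < 1 & forall k, `|f k| <= M * r ^+ k].

Lemma geometrically_bounded_cvg f K : 0 < K -> geometrically_bounded f K ->
  cvgn (pseries f K).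
Proof.
move=> K0 [M [r [M0 r0 rK fM]]]; apply: normed_cvg.
apply: (@series_le_cvg _ _ (geometric M (r * K))) => [n|n|n|].
- exact: normr_ge0.
- by rewrite /= mulr_ge0// exprn_ge0// mulr_ge0 ?ltW.
- by rewrite /= normrM normrX (gtr0_norm K0) exprMn mulrA ler_wpM2r// exprn_ge0// ltW.
by apply: is_cvg_geometric_series; rewrite ger0_norm// mulr_ge0// ltW.
Qed.

Lemma bernoulli (d : R) k : 0 <= d -> 1 + k%:R * d <= (1 + d) ^+ k.
Proof.
move=> d0; elim: k => [|k IH]; first by rewrite mul0r addr0 expr0.
rewrite exprS (le_trans _ (ler_wpM2l _ IH))//; last by rewrite addr_ge0.
have := mulr_ge0 (ler0n R k) (mulr_ge0 d0 d0); rewrite -natr1; lra.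
Qed.

(** The factor [k + 1] is absorbed by enlarging [r] to [s = r (1 + d)], the midpoint of [r] and
    [1 / K]: Bernoulli's inequality gives [k + 1 <= (1 + 1 / d) (1 + d)^k]. *)
Lemma geometrically_bounded_diffs f K : 0 < K ->
  geometrically_bounded f K -> geometrically_bounded (pseries_diffs f) K.
Proof.
move=> K0 [M [r [M0 r0 rK fM]]].
have rVK : r < K^-1 by rewrite -div1r ltr_pdivlMr.
pose s := (r + K^-1) / 2; have rs : r < s by rewrite /s; lra.
pose d := s / r - 1; have d0 : 0 < d by rewrite subr_gt0 ltr_pdivlMr ?mul1r.
exists (M * r * (1 + d^-1)), s; split.
- have := ltW r0; have : 0 <= d^-1 by rewrite invr_ge0 ltW.
  by move=> ? ?; rewrite !mulr_ge0// addr_ge0.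
- lra.
- by rewrite -ltr_pdivlMr// div1r /s; lra.
move=> k; rewrite /pseries_diffs normrM normr_nat.
apply: (le_trans (ler_wpM2l (ler0n _ _) (fM k.+1))).
have sE : s ^+ k = r ^+ k * (1 + d) ^+ k.
  by rewrite -exprMn /d addrC subrK mulrC divfK ?gt_eqF.
have -> : M * r * (1 + d^-1) * s ^+ k =
    (M * (r * r ^+ k)) * ((1 + d^-1) * (1 + d) ^+ k) by rewrite sE; ring.
rewrite exprS.
rewrite mulrC ler_wpM2l//; first by have r0' := ltW r0; rewrite !mulr_ge0// exprn_ge0.
rewrite -natr1 mulrDl mul1r addrC lerD//.
  by rewrite (le_trans _ (bernoulli k (ltW d0)))// lerDl mulr_ge0// ltW.
rewrite mulrC ler_pdivlMr//.
by rewrite (le_trans _ (bernoulli k (ltW d0)))// lerDr.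
Qed.

Lemma is_derive_pseries f K x : 0 < K -> geometrically_bounded f K ->
  `|x| < K -> is_derive x (1 : R) (fun x => limn (pseries f x))
    (limn (pseries (pseries_diffs f) x)).
Proof.
move=> K0 fK xK; have K' : `|x| < `|K| by rewrite (gtr0_norm K0).
(* Convergence at [K] is required of the series and of its first two termwise derivatives. *)
apply: (pseries_snd_diffs _ _ _ K'); apply: geometrically_bounded_cvg => //;
  by do ?apply: geometrically_bounded_diffs.
Qed.

End GeometricPseries.

(** * The exponential of the complex logarithm series *)

Section ComplexLog.
Local Open Scope classical_set_scope.
Local Open Scope ring_scope.
Variable R : realType.
Local Notation C := R[i].

Lemma Re_norm_le (z : C) (r : R) : `|z| <= r%:C -> `|complex.Re z| <= r.
Proof. by move=> zr; rewrite -lecR; apply: le_trans zr; exact: normc_ge_Re. Qed.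

Lemma Im_norm_le (z : C) (r : R) : `|z| <= r%:C -> `|complex.Im z| <= r.
Proof.
move=> zr; rewrite -lecR; apply: le_trans zr.
have -> : complex.Im z = complex.Re (z * - 'i%C).
  by case: z => a b /=; ring.
rewrite (le_trans (normc_ge_Re _))// normrM normrN.
by rewrite (_ : `|'i%C| = 1 :> C) ?mulr1// normc_def/= expr0n expr1n add0r sqrtr1.
Qed.

Lemma Re_add (z w : C) : complex.Re (z + w) = complex.Re z + complex.Re w.
Proof. by case: z w => [? ?] [? ?]. Qed.
Lemma Im_add (z w : C) : complex.Im (z + w) = complex.Im z + complex.Im w.
Proof. by case: z w => [? ?] [? ?]. Qed.
Lemma ReM (z w : C) :
  complex.Re (z * w) = complex.Re z * complex.Re w - complex.Im z * complex.Im w.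
Proof. by case: z w => [? ?] [? ?]. Qed.
Lemma ImM (z w : C) :
  complex.Im (z * w) = complex.Re z * complex.Im w + complex.Im z * complex.Re w.
Proof. by case: z w => [? ?] [? ?]. Qed.
Lemma ReMr (z : C) (r : R) : complex.Re (z * r%:C) = complex.Re z * r.
Proof. by rewrite ReM/= mulr0 subr0. Qed.
Lemma ImMr (z : C) (r : R) : complex.Im (z * r%:C) = complex.Im z * r.
Proof. by rewrite ImM/= mulr0 add0r. Qed.

Variables (l : C) (r : R).
Hypotheses (r01 : 0 < r < 1) (lr : `|l| <= r%:C).

Let x := complex.Re l.
Let y := complex.Im l.
(** [a t] and [b t] below are the real and imaginary parts of [- log (1 - t l)], expanded in powers
    of [t]. The coefficient at [k = 0] vanishes because the inverse of 0 is 0. *)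
Let fa k := complex.Re (l ^+ k / k%:R).
Let fb k := complex.Im (l ^+ k / k%:R).
Let a (t : R) : R := limn (pseries fa t).
Let b (t : R) : R := limn (pseries fb t).
Let a' (t : R) : R := limn (pseries (pseries_diffs fa) t).
Let b' (t : R) : R := limn (pseries (pseries_diffs fb) t).
(** Chosen with [1 < K < 1 / r], so that the closed unit interval lies strictly inside the disc of
    radius [K]. *)
Let K := 2 / (r + 1).

Let K1 : 1 < K.
Proof. by have /andP[? ?] := r01; rewrite ltr_pdivlMr; lra. Qed.

Let r0 : 0 < r. Proof. by case/andP: r01. Qed.

Let rK : r * K < 1.
Proof. by have /andP[? ?] := r01; rewrite /K mulrA ltr_pdivrMr; lra. Qed.

Let natC k : k%:R = (k%:R : R)%:C :> C.
Proof. by rewrite rmorph_nat. Qed.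

Let faE k : fa k = complex.Re (l ^+ k) / k%:R.
Proof. by rewrite /fa natC -fmorphV ReMr. Qed.

Let fbE k : fb k = complex.Im (l ^+ k) / k%:R.
Proof. by rewrite /fb natC -fmorphV ImMr. Qed.

Let norm_pow k : `|l ^+ k| <= (r ^+ k)%:C.
Proof. by rewrite normrX rmorphXn/= lerXn2r// nnegrE ?ler0c ?ltW. Qed.

Let natV_le1 k : `|(k%:R : R)^-1| <= 1.
Proof.
rewrite normfV normr_nat; case: k => [|k]; first by rewrite invr0.
by rewrite invf_le1 ?ltr0n// ler1n.
Qed.

Let geo_fa : geometrically_bounded fa K.
Proof.
exists 1, r; split=> // k; rewrite faE normrM mul1r -[leRHS]mulr1.
by apply: ler_pM => //; exact/Re_norm_le/norm_pow.
Qed.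

Let geo_fb : geometrically_bounded fb K.
Proof.
exists 1, r; split=> // k; rewrite fbE normrM mul1r -[leRHS]mulr1.
by apply: ler_pM => //; exact/Im_norm_le/norm_pow.
Qed.

Let K0 : 0 < K. Proof. by rewrite (lt_trans ltr01). Qed.

Let tK (t : R) : 0 <= t <= 1 -> `|t| < K.
Proof. by move=> /andP[t0 t1]; rewrite ger0_norm// (le_lt_trans t1). Qed.

Let diffs_fa : pseries_diffs fa = fun k => complex.Re (l ^+ k.+1).
Proof. by apply/funext => k; rewrite /pseries_diffs faE mulrC divfK// pnatr_eq0. Qed.

Let diffs_fb : pseries_diffs fb = fun k => complex.Im (l ^+ k.+1).
Proof. by apply/funext => k; rewrite /pseries_diffs fbE mulrC divfK// pnatr_eq0. Qed.

Let cvg_a' (t : R) : 0 <= t <= 1 -> pseries (pseries_diffs fa) t @ \oo --> a' t.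
Proof.
move=> t01; apply: (@is_cvg_pseries_inside _ _ K); last by rewrite (gtr0_norm K0) tK.
exact/geometrically_bounded_cvg/geometrically_bounded_diffs.
Qed.

Let cvg_b' (t : R) : 0 <= t <= 1 -> pseries (pseries_diffs fb) t @ \oo --> b' t.
Proof.
move=> t01; apply: (@is_cvg_pseries_inside _ _ K); last by rewrite (gtr0_norm K0) tK.
exact/geometrically_bounded_cvg/geometrically_bounded_diffs.
Qed.

(** The differentiated series is the geometric series of [l (t l)^k], whose partial sums telescope
    under [1 - t l]. *)
Let partial_sum (t : R) (n : nat) : (1 - t%:C * l) *
  (pseries (pseries_diffs fa) t n +i* pseries (pseries_diffs fb) t n) =
  l - l * (t%:C * l) ^+ n.
Proof.
have -> : pseries (pseries_diffs fa) t n +i* pseries (pseries_diffs fb) t n =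
    \sum_(0 <= k < n) l * (t%:C * l) ^+ k.
  rewrite diffs_fa diffs_fb /pseries/=.
  elim: n => [|n IH]; first by rewrite /series/= !big_nil.
  rewrite /series/= !big_nat_recr//= -IH.
  have -> : l * (t%:C * l) ^+ n = l ^+ n.+1 * (t ^+ n)%:C.
    by rewrite exprMn rmorphXn/= exprS; ring.
  by apply/eqP; rewrite eq_complex Re_add Im_add ReMr ImMr/= !eqxx.
rewrite big_mkord -mulr_sumr mulrCA -(opprB (t%:C * l) 1) mulNr -subrX1.
by rewrite opprB mulrBr mulr1.
Qed.

Let tail_cvg0 (t : R) : 0 <= t <= 1 ->
  (fun n => complex.Re (l * (t%:C * l) ^+ n)) @ \oo --> 0 /\
  (fun n => complex.Im (l * (t%:C * l) ^+ n)) @ \oo --> 0.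
Proof.
move=> /andP[t0 t1].
have rn0 : (fun n => r ^+ n) @ \oo --> (0 : R).
  by apply: cvg_expr; have /andP[? ?] := r01; rewrite ger0_norm// ltW.
have rNn0 : (fun n => - r ^+ n) @ \oo --> (0 : R).
  by rewrite -[0]oppr0; exact: cvgN.
have le n : `|l * (t%:C * l) ^+ n| <= (r ^+ n)%:C.
  rewrite normrM normrX normrM rmorphXn/= -[leRHS]mul1r.
  have l1 : `|l| <= 1 by rewrite (le_trans lr)// lecR ltW//; case/andP: r01.
  apply: ler_pM => //.
  apply: lerXn2r; rewrite ?nnegrE ?mulr_ge0// ?ler0c ?(ltW r0)//.
  rewrite -[leRHS]mul1r; apply: ler_pM => //.
  by rewrite normc_def/= expr0n addr0 sqrtr_sqr ger0_norm// lecR.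
split; apply: (squeeze_cvgr _ rNn0 rn0); apply: nearW => n; rewrite -ler_norml.
  exact: Re_norm_le.
exact: Im_norm_le.
Qed.

(** The real and imaginary parts of [(1 - t l) (a' + i b') = l], the limit of [partial_sum]. *)
Let ode (t : R) : 0 <= t <= 1 ->
  (1 - t * x) * a' t + t * y * b' t = x /\
  (1 - t * x) * b' t - t * y * a' t = y.
Proof.
move=> t01; have [tR tI] := tail_cvg0 t01.
have ReE n : (1 - t * x) * pseries (pseries_diffs fa) t n +
    t * y * pseries (pseries_diffs fb) t n =
    x - complex.Re (l * (t%:C * l) ^+ n).
  have /(congr1 (@complex.Re R)) := partial_sum t n.
  rewrite /x /y; set z := (_ * l) ^+ n; clearbody z.
  by move: z; case: (l) => p q [u v] /= E; lra.
have ImE n : (1 - t * x) * pseries (pseries_diffs fb) t n -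
    t * y * pseries (pseries_diffs fa) t n =
    y - complex.Im (l * (t%:C * l) ^+ n).
  have /(congr1 (@complex.Im R)) := partial_sum t n.
  rewrite /x /y; set z := (_ * l) ^+ n; clearbody z.
  by move: z; case: (l) => p q [u v] /= E; lra.
have ca := cvg_a' t01; have cb := cvg_b' t01; split.
- have h1 : (fun n => (1 - t * x) * pseries (pseries_diffs fa) t n +
    t * y * pseries (pseries_diffs fb) t n) @ \oo -->
    (1 - t * x) * a' t + t * y * b' t.
    by apply: cvgD; apply: cvgM => //; exact: cvg_cst.
  have h2 : (fun n => x - complex.Re (l * (t%:C * l) ^+ n)) @ \oo --> x - 0.
    by apply: cvgB => //; exact: cvg_cst.
  rewrite subr0 -(funext ReE) in h2.
  exact: cvg_unique h1 h2.
- have h1 : (fun n => (1 - t * x) * pseries (pseries_diffs fb) t n -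
    t * y * pseries (pseries_diffs fa) t n) @ \oo -->
    (1 - t * x) * b' t - t * y * a' t.
    by apply: cvgB; apply: cvgM => //; exact: cvg_cst.
  have h2 : (fun n => y - complex.Im (l * (t%:C * l) ^+ n)) @ \oo --> y - 0.
    by apply: cvgB => //; exact: cvg_cst.
  rewrite subr0 -(funext ImE) in h2.
  exact: cvg_unique h1 h2.
Qed.

Let da (t : R) : 0 <= t <= 1 -> is_derive t (1 : R) a (a' t).
Proof. by move=> t01; apply: (is_derive_pseries K0 geo_fa (tK t01)). Qed.

Let db (t : R) : 0 <= t <= 1 -> is_derive t (1 : R) b (b' t).
Proof. by move=> t01; apply: (is_derive_pseries K0 geo_fb (tK t01)). Qed.

Let eq01 (H : R -> R) : (forall t : R, 0 <= t <= 1 -> is_derive t (1 : R) H 0) ->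
  H 1 = H 0.
Proof.
move=> dH; have [||c _] := @MVT_segment R H (cst 0) 0 1 ler01.
- by move=> t; rewrite in_itv/= => /andP[? ?]; apply: dH; rewrite !ltW.
- apply: derivable_within_continuous => t; rewrite in_itv/= => t01.
  by have [] := dH _ t01.
by rewrite mul0r => /eqP; rewrite subr_eq0 => /eqP.
Qed.

(** [Hre + i Him] is [(1 - t l) exp (a + i b)]; it is constant on the unit interval and equals 1 at
    [t = 0]. *)
Let Hre (t : R) : R := expR (a t) * ((1 - t * x) * cos (b t) + t * y * sin (b t)).
Let Him (t : R) : R := expR (a t) * ((1 - t * x) * sin (b t) - t * y * cos (b t)).

Let dlin (p q t : R) : is_derive t (1 : R) (fun s => p + s * q) q.
Proof.
have -> : (fun s => p + s * q) = cst p + id * cst q by apply/funext.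
apply: is_derive_eq.
by rewrite /GRing.scale/= mulr0 add0r mulr1 add0r.
Qed.

(** One product rule serves [Hre] and [Him], which differ by exchanging [cos] and [sin] and by the
    sign of [q']. *)
Let dcomp (P U V : R -> R) (p q p' q' u' v' t : R) :
  is_derive t (1 : R) P (expR (a t) * a' t) -> P t = expR (a t) ->
  is_derive t (1 : R) U u' -> is_derive t (1 : R) V v' ->
  is_derive t (1 : R) (fun s => P s * ((p + s * p') * U s + (q + s * q') * V s))
   (expR (a t) * (a' t * ((p + t * p') * U t + (q + t * q') * V t) +
     (p' * U t + q' * V t) + ((p + t * p') * u' + (q + t * q') * v'))).
Proof.
move=> dP Pt dU dV; have d1 := dlin p p' t; have d2 := dlin q q' t.
have -> : (fun s => P s * ((p + s * p') * U s + (q + s * q') * V s)) =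
   P * ((fun s => p + s * p') * U + (fun s => q + s * q') * V) by apply/funext.
apply: is_derive_eq; rewrite /GRing.scale/= Pt !fctE; ring.
Qed.

Let dexp (t : R) : 0 <= t <= 1 -> is_derive t (1 : R) (expR \o a) (expR (a t) * a' t).
Proof. by move=> /da ?; apply: is_derive1_comp. Qed.

Let dcos (t : R) : 0 <= t <= 1 -> is_derive t (1 : R) (cos \o b) (- sin (b t) * b' t).
Proof. by move=> /db ?; apply: is_derive1_comp. Qed.

Let dsin (t : R) : 0 <= t <= 1 -> is_derive t (1 : R) (sin \o b) (cos (b t) * b' t).
Proof. by move=> /db ?; apply: is_derive1_comp. Qed.

Let dHre (t : R) : 0 <= t <= 1 -> is_derive t (1 : R) Hre 0.
Proof.
move=> t01; have [E1 E2] := ode t01.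
have := dcomp 1 0 (- x) y (dexp t01) erefl (dcos t01) (dsin t01).
set D := (X in is_derive _ _ _ X).
have -> : D = 0.
  rewrite /D/=; set s := sin _; set c := cos _.
  apply/eqP; rewrite mulf_eq0; apply/orP; right; apply/eqP.
  (* The bracket is [cos] times the residual of the first equation of [ode] minus [sin] times that
     of the second. *)
  transitivity (c * ((1 - t * x) * a' t + t * y * b' t - x) -
    s * ((1 - t * x) * b' t - t * y * a' t - y)); first by ring.
  by rewrite E1 E2 !subrr !mulr0 subrr.
congr (is_derive _ _ _ _); apply/funext => u; rewrite /Hre/=; ring.
Qed.

Let dHim (t : R) : 0 <= t <= 1 -> is_derive t (1 : R) Him 0.
Proof.
move=> t01; have [E1 E2] := ode t01.
have := dcomp 1 0 (- x) (- y) (dexp t01) erefl (dsin t01) (dcos t01).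
set D := (X in is_derive _ _ _ X).
have -> : D = 0.
  rewrite /D/=; set s := sin _; set c := cos _.
  apply/eqP; rewrite mulf_eq0; apply/orP; right; apply/eqP.
  transitivity (s * ((1 - t * x) * a' t + t * y * b' t - x) +
    c * ((1 - t * x) * b' t - t * y * a' t - y)); first by ring.
  by rewrite E1 E2 !subrr !mulr0 addr0.
congr (is_derive _ _ _ _); apply/funext => u; rewrite /Him/=; ring.
Qed.

Let pseries0 f : f 0%N = 0 -> limn (pseries f 0) = 0 :> R.
Proof.
move=> f0; rewrite (_ : pseries f 0 = cst 0) ?lim_cst//.
apply/funext => n; rewrite /pseries/series/= big1// => -[|k] _.
  by rewrite f0 mul0r.
by rewrite expr0n mulr0.
Qed.

(** At [t = 1] the conserved quantity reads [(1 - l) exp (a 1 + i b 1) = 1]; inverting the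
    exponential uses [cos^2 + sin^2 = 1] and no branch of the logarithm. *)
Lemma cexp_log_series : exists A B : R,
  [/\ series (fun k => complex.Re (l ^+ k / k%:R)) @ \oo --> A,
      series (fun k => complex.Im (l ^+ k / k%:R)) @ \oo --> B &
      cexp (- (A +i* B)) = 1 - l].
Proof.
have p1 f : pseries f 1 = series f :> (nat -> R).
  apply/funext => n; rewrite /pseries /series/=; apply: eq_bigr => k _.
  by rewrite expr1n mulr1.
exists (a 1), (b 1); split.
- rewrite -/fa -p1; apply: (@is_cvg_pseries_inside _ _ K).
    exact: geometrically_bounded_cvg.
  by rewrite (gtr0_norm K0) tK// lexx ler01.
- rewrite -/fb -p1; apply: (@is_cvg_pseries_inside _ _ K).
    exact: geometrically_bounded_cvg.
  by rewrite (gtr0_norm K0) tK// lexx ler01.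
have a0 : a 0 = 0 by apply: pseries0; rewrite faE invr0 mulr0.
have b0 : b 0 = 0 by apply: pseries0; rewrite fbE invr0 mulr0.
have := eq01 dHre; have := eq01 dHim.
rewrite /Hre /Him a0 b0 expR0 cos0 sin0 => HI HR.
have e0 : expR (a 1) != 0 by rewrite gt_eqF// expR_gt0.
have I0 : (1 - x) * sin (b 1) - y * cos (b 1) = 0.
  by apply: (mulfI e0); lra.
have R1 : expR (a 1) * ((1 - x) * cos (b 1) + y * sin (b 1)) = 1 by lra.
have cs := cos2Dsin2 (b 1).
rewrite /cexp/= expRN sinN cosN.
have Ve : (expR (a 1))^-1 = (1 - x) * cos (b 1) + y * sin (b 1).
  by apply: (mulfI e0); rewrite R1 mulfV.
apply/eqP; rewrite eq_complex Ve -/x.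
rewrite ReM ImM/= !mul0r subr0 addr0 -/x -/y.
move: cs I0; set c := cos _; set s := sin _ => cs I0.
have {}I0 : (1 - x) * s = y * c by lra.
have -> : complex.Re (1 - l) = 1 - x by rewrite /x; case: (l).
have -> : complex.Im (1 - l) = - y by rewrite /y; case: (l) => p q /=; rewrite sub0r.
apply/andP; split; apply/eqP.
- transitivity ((1 - x) * c ^+ 2 + y * c * s); first by ring.
  by rewrite -I0 -mulrA -expr2 -mulrDr cs mulr1.
- transitivity (- ((1 - x) * s * c + y * s ^+ 2)); first by ring.
  by rewrite I0 -mulrA -expr2 -mulrDr cs mulr1.
Qed.

End ComplexLog.

(** * Loops *)

Section LoopInvariants.
Local Open Scope quotient_scope.
Local Open Scope ring_scope.
Variable V : finType.
Local Notation unroot := (\pi_(unrooted_loop V)).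
Implicit Types (w : rooted_loop V) (l : unrooted_loop V).

Lemma path_edges_rcons (x y : V) p :
  path_edges (x :: rcons p y) = rcons (path_edges (x :: p)) (last x p, y).
Proof.
rewrite /path_edges/=; elim: p x => [//|z p IH] x /=.
by rewrite IH.
Qed.

Lemma path_edges_loop_shift (w : seq V) : nontrivial_loop w ->
  perm_eq (path_edges (loop_shift w)) (path_edges w).
Proof.
case: w => [//|x [//|y p]] /= /eqP yx.
by rewrite path_edges_rcons yx perm_rcons.
Qed.

Lemma nontrivial_loop_shift (w : seq V) : nontrivial_loop w ->
  nontrivial_loop (loop_shift w).
Proof.
case: w => [//|x [//|y p]] /= _.
by rewrite last_rcons eqxx andbT; case: p.
Qed.

Lemma eq_pi_loop (w w' : rooted_loop V) :
  (unroot w = unroot w') <->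
  exists n, iter n (@loop_shift V) (val w) = val w'.
Proof.
split=> [/eqmodP/asboolP //|h]; apply/eqmodP/asboolP; exact: h.
Qed.

Lemma path_edges_pi (w w' : rooted_loop V) :
  unroot w = unroot w' ->
  perm_eq (path_edges (val w)) (path_edges (val w')).
Proof.
move=> /eq_pi_loop[n <-]; rewrite perm_sym.
suff [] : nontrivial_loop (iter n (@loop_shift V) (val w)) /\
  perm_eq (path_edges (iter n (@loop_shift V) (val w))) (path_edges (val w)) by [].
elim: n => [|n [IH1 IH2]]; first by split=> //; exact: valP.
rewrite iterS; split; first exact: nontrivial_loop_shift.
by apply: perm_trans IH2; exact: path_edges_loop_shift.
Qed.

Lemma size_path_edges (w : seq V) : size (path_edges w) = path_length w.
Proof. by rewrite size_zip size_behead; apply/minn_idPr; rewrite leq_pred. Qed.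

Lemma path_length_pi (w w' : rooted_loop V) :
  unroot w = unroot w' -> path_length (val w) = path_length (val w').
Proof. by move=> /path_edges_pi/perm_size; rewrite !size_path_edges. Qed.

Lemma edge_count_pi (w : rooted_loop V) :
  loop_edge_count (unroot w) = edge_count (val w).
Proof.
apply/funext => u; apply/funext => v; rewrite /loop_edge_count /edge_count.
have /permP := path_edges_pi (reprK (unroot w)); exact.
Qed.

Lemma path_weight_pi (R : realType) (q : V -> V -> R[i]) (w w' : rooted_loop V) :
  unroot w = unroot w' -> path_weight q (val w) = path_weight q (val w').
Proof. by move=> /path_edges_pi pe; apply: perm_big. Qed.

Definition tuple_root k (t : k.+1.-tuple V) : V := last (thead t) t.

Lemma tuple_root_last k (t : k.+1.-tuple V) x : last x t = tuple_root t.
Proof. by case/tupleP: t => y s. Qed.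

Lemma nontrivial_tuple k (t : k.+1.-tuple V) :
  nontrivial_loop (tuple_root t :: t).
Proof.
by rewrite /= tuple_root_last eqxx andbT; case/tupleP: t.
Qed.

(* A rooted loop of length k + 1 is encoded by its vertices after the root; the
   last of them is the root again. *)
Definition tuple_loop k (t : k.+1.-tuple V) : rooted_loop V :=
  exist (fun p : seq V => nontrivial_loop p) _ (nontrivial_tuple t).

Lemma tuple_loop_inj k : injective (@tuple_loop k).
Proof. by move=> s t /(congr1 val) [_ st]; apply/val_inj. Qed.

Lemma tuple_loop_length k (t : k.+1.-tuple V) :
  path_length (val (tuple_loop t)) = k.+1.
Proof. by rewrite /path_length/= size_tuple. Qed.

Lemma tuple_loop_surj w k : path_length (val w) = k.+1 ->
  exists t : k.+1.-tuple V, w = tuple_loop t.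
Proof.
case: w => -[//|x p] xp; rewrite /path_length/= => sp.
exists (Tuple (introT eqP sp)); apply/val_inj => /=; congr (_ :: _).
by move: xp; rewrite /= => /andP[_ /eqP]; case: (p) sp.
Qed.

Lemma path_length_gt0 w : (0 < path_length (val w))%N.
Proof. by case: w => -[//|x [//|y p]]. Qed.

Lemma pi_tuple_loop_rot k (t : k.+1.-tuple V) :
  unroot (tuple_loop [tuple of rot 1 t]) = unroot (tuple_loop t).
Proof.
apply/esym/eq_pi_loop; exists 1%N; rewrite iter_loop_shift//=.
- by rewrite (tuple_root_last [tuple of rot 1 t]).
- by case/tupleP: (t).
- exact: tuple_root_last.
Qed.

Definition loop_length l := path_length (val (repr l)).

Lemma loop_length_gt0 l : (0 < loop_length l)%N.
Proof. exact: path_length_gt0. Qed.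

Lemma loop_length_pi w : loop_length (unroot w) = path_length (val w).
Proof. by apply: path_length_pi; rewrite reprK. Qed.

(* The loops of length k + 1, not k. *)
Definition loops_of_length k : {fset unrooted_loop V} :=
  [fset unroot (tuple_loop t) | t : k.+1.-tuple V]%fset.

Lemma mem_loops_of_length k l : (l \in loops_of_length k) = (loop_length l == k.+1).
Proof.
apply/imfsetP/eqP => [[t _ ->]|lk]; first by rewrite loop_length_pi tuple_loop_length.
have [t wt] := tuple_loop_surj lk; exists t => //.
by rewrite -wt reprK.
Qed.

Lemma mem_loops_of_length_pred k l :
  (l \in loops_of_length k) = ((loop_length l).-1 == k).
Proof.
by rewrite mem_loops_of_length; case: (loop_length l) (loop_length_gt0 l).
Qed.

(** Each entry of [t] is the endpoint of exactly one step of the loop, so the in-degree at [u]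
    counts the visits to [u]. *)
Lemma loop_indegree l u k (t : k.+1.-tuple V) : l = unroot (tuple_loop t) ->
  (\sum_v loop_edge_count l v u)%N = count_mem u t.
Proof.
move=> ->; rewrite edge_count_pi /edge_count /path_edges/=.
have -> : count_mem u t = count (fun e : V * V => e.2 == u) (zip (tuple_root t :: t) t).
  by rewrite -[in LHS](@unzip2_zip _ _ (tuple_root t :: t) t)//= count_map.
under eq_bigr do rewrite -sum1_count.
rewrite -sum1_count (exchange_big_dep (fun e : V * V => e.2 == u))/=; last first.
  by move=> v [a b] _ /eqP[_ ->].
apply: eq_bigr => -[a b] /= /eqP ->; rewrite (big_pred1 a)// => v.
by rewrite xpair_eqE eqxx andbT eq_sym.
Qed.

Lemma loop_edges_total l : (\sum_u \sum_v loop_edge_count l u v)%N = loop_length l.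
Proof.
rewrite pair_big/= /loop_edge_count /edge_count /loop_length -size_path_edges.
rewrite -(count_predT (path_edges _)).
under eq_bigr do rewrite -sum1_count.
rewrite -sum1_count (exchange_big_dep xpredT)//=.
by apply: eq_bigr => -[a b] _; rewrite (big_pred1 (a, b))// => -[c d]; rewrite eq_sym.
Qed.

End LoopInvariants.

Lemma big_tuple_cons (M : nmodType) (V : finType) k (F : k.+1.-tuple V -> M) :
  \sum_t F t = \sum_v \sum_(t : k.-tuple V) F [tuple of v :: t].
Proof.
rewrite pair_big/=.
rewrite (reindex (fun p : V * k.-tuple V => [tuple of p.1 :: p.2]))//=.
exists (fun t : k.+1.-tuple V => (thead t, [tuple of behead t])) => [[v t] _|t _].
  by congr pair; apply/val_inj.
by case/tupleP: t => v t; apply/val_inj.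
Qed.

(** * Averaging over rotations *)

Section RotationAverage.
Variables (V : finType) (R : comPzRingType).

(** [count_mem u t] counts the positions of [u] in [t]. Rotation moves any position to the last one,
    where the root stands, so all [k + 1] positions contribute the same sum. *)
Lemma sum_count_mem k (h : k.+1.-tuple V -> R) u :
  (forall t : k.+1.-tuple V, h [tuple of rot 1 t] = h t) ->
  \sum_(t : k.+1.-tuple V) (count_mem u t)%:R * h t =
  k.+1%:R * \sum_(t : k.+1.-tuple V | tuple_root t == u) h t.
Proof.
move=> hrot; pose S j := \sum_(t : k.+1.-tuple V | nth u t j == u) h t.
have rot_bij : bijective (fun t : k.+1.-tuple V => [tuple of rot 1 t]).
  by exists (fun t : k.+1.-tuple V => [tuple of rotr 1 t]) => t;
    apply/val_inj; rewrite /= ?rotK ?rotrK.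
have Sk j : (j <= k)%N -> S j = S k.
  (* Induction on the distance to [k]; once it reaches [k], truncated subtraction keeps the position
     at 0. *)
  move=> jk; rewrite -(subKn jk); elim: (k - j)%N => [|i IH]; first by rewrite subn0.
  have [ik|ki] := ltnP i k; last first.
    by move: (ki); rewrite -subn_eq0 => /eqP E; rewrite subnS -[RHS]IH E.
  rewrite -IH /S (reindex (fun t : k.+1.-tuple V => [tuple of rot 1 t]))/=;
    last exact: onW_bij.
  rewrite -(subnSK ik); apply: eq_big => [t|t _]; last exact: hrot.
  case/tupleP: t => x t /=; rewrite rot1_cons nth_rcons size_tuple.
  by rewrite ifT//= -subn_gt0 subKn.
have -> : \sum_(t | tuple_root t == u) h t = S k.
  apply: eq_bigl => t; rewrite -(tuple_root_last t u) (last_nth u).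
  by rewrite size_tuple.
transitivity (\sum_(j < k.+1) S j); last first.
  rewrite (eq_bigr (fun=> S k)) => [|j _]; last by rewrite Sk// -ltnS.
  by rewrite sumr_const card_ord mulr_natl.
rewrite (exchange_big_dep xpredT)//=; apply: eq_bigr => t _.
rewrite sumr_const -[RHS]mulr_natl; congr (_%:R * _).
rewrite -sum1_count (big_nth u) size_tuple big_mkord sum1_card.
by apply: eq_card.
Qed.

End RotationAverage.

Section LoopMeasure.
Local Open Scope quotient_scope.
Local Open Scope ring_scope.
Variables (R : realType) (V : finType) (q : V -> V -> R[i]).
Local Notation C := R[i].
Local Notation unroot := (\pi_(unrooted_loop V)).

(** All members of a class have the same length, so the sum over the class runs over tuples of one
    size. *)
Lemma loop_measureE k (t : k.+1.-tuple V) :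
  loop_measure q (unroot (tuple_loop t)) =
  \sum_(s : k.+1.-tuple V | unroot (tuple_loop s) == unroot (tuple_loop t))
    path_weight q (val (tuple_loop s)) / k.+1%:R.
Proof.
rewrite /loop_measure [RHS]bigfs ?index_enum_uniq//; last first.
  by move=> i _; rewrite mem_index_enum.
rewrite (reindex_fsbig (@tuple_loop V k)
  [set s | unroot (tuple_loop s) == unroot (tuple_loop t)]%classic); last first.
  split.
  - by move=> s /= /eqP.
  - by move=> s s' _ _ /tuple_loop_inj.
  move=> w /= wt; have [|s ws] := @tuple_loop_surj V w k.
    by rewrite -(tuple_loop_length t); apply: path_length_pi.
  by exists s; rewrite /= -ws// wt.
by apply: eq_fsbigr => s _; rewrite tuple_loop_length.
Qed.

Lemma sum_loops_of_length k (phi : unrooted_loop V -> C) :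
  \sum_(l <- loops_of_length V k) loop_measure q l * phi l =
  \sum_(t : k.+1.-tuple V) path_weight q (val (tuple_loop t)) / k.+1%:R *
    phi (unroot (tuple_loop t)).
Proof.
transitivity (\sum_(l <- loops_of_length V k) \sum_(t : k.+1.-tuple V |
  unroot (tuple_loop t) == l)
    path_weight q (val (tuple_loop t)) / k.+1%:R * phi (unroot (tuple_loop t))).
  apply: eq_big_seq => l /imfsetP[/= t _ ->].
  rewrite loop_measureE mulr_suml.
  by apply: eq_bigr => s /eqP ->.
rewrite (exchange_big_dep xpredT)//=; apply: eq_bigr => t _.
rewrite big_mkcond (bigD1_seq (unroot (tuple_loop t))) ?fset_uniq//=.
  by rewrite eqxx big1 ?addr0// => l /negPf; rewrite eq_sym => ->.
by rewrite mem_loops_of_length loop_length_pi tuple_loop_length.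
Qed.

(** By [sum_count_mem], weighting by the visits to [u] cancels the factor [1 / k.+1] of the loop
    measure and leaves the loops rooted at [u] with their full weight. *)
Lemma sum_loops_indegree k (phi : unrooted_loop V -> C) u :
  \sum_(l <- loops_of_length V k)
    (\sum_v loop_edge_count l v u)%:R * (loop_measure q l * phi l) =
  \sum_(t : k.+1.-tuple V | tuple_root t == u)
    path_weight q (val (tuple_loop t)) * phi (unroot (tuple_loop t)).
Proof.
under eq_bigr do rewrite mulrCA.
rewrite (sum_loops_of_length k (fun l => (\sum_v loop_edge_count l v u)%:R * phi l)).
have k0 : (k.+1%:R : C) != 0 by rewrite pnatr_eq0.
apply: (mulfI k0); rewrite -sum_count_mem => [|t]; last first.
  rewrite pi_tuple_loop_rot; congr (_ * _).
  by apply: path_weight_pi; exact: pi_tuple_loop_rot.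
rewrite mulr_sumr; apply: eq_bigr => t _.
rewrite (loop_indegree u erefl).
have cancel_length (c w p m : C) : c != 0 -> c * (w / c * (m * p)) = m * (w * p).
  by move=> c0; field.
exact: cancel_length.
Qed.

End LoopMeasure.

(** * Closed paths and traces of powers *)

Section WeightPower.
Variables (R : realType) (V : finType) (q : V -> V -> R[i]).

(** The entry of [Q^k] at [x] and [y], indexed by vertices instead of ordinals and built by summing
    over the first step. *)
Definition weight_pow k (x y : V) : R[i] :=
  iter k (fun f x => \sum_v q x v * f v) (fun x => (x == y)%:R) x.

Lemma path_weight_cons (x y : V) p :
  path_weight q (x :: y :: p) = q x y * path_weight q (y :: p).
Proof. by rewrite /path_weight/= big_cons. Qed.

Lemma weight_powE k x y :
  weight_pow k x y = \sum_(t : k.-tuple V | last x t == y) path_weight q (x :: t).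
Proof.
elim: k x => [|k IH] x.
  rewrite big_mkcond (big_pred1 [tuple]) => [|t]; last by rewrite [t]tuple0 /= eqxx.
  by rewrite /weight_pow/= /path_weight big_nil; case: eqP.
rewrite [RHS]big_mkcond big_tuple_cons /weight_pow iterS; apply: eq_bigr => v _.
rewrite -/(weight_pow k v y) IH mulr_sumr [LHS]big_mkcond/=.
by apply: eq_bigr => t _; case: ifP => // _; rewrite path_weight_cons.
Qed.

Lemma enum_val_cast_bij n (e : #|V| = n.+1) :
  bijective (fun i => @enum_val V V (cast_ord (esym e) i)).
Proof.
exists (fun x => cast_ord e (enum_rank x)) => a.
  by rewrite enum_valK cast_ordKV.
by rewrite cast_ordK enum_rankK.
Qed.

(** The cast gives the weight matrix the visibly positive size [n.+1] of the spectral lemmas. *)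
Lemma weight_mx_powE n (e : #|V| = n.+1) k i j :
  (castmx (e, e) (weight_mx q) ^+ k) i j =
  weight_pow k (enum_val (cast_ord (esym e) i)) (enum_val (cast_ord (esym e) j)).
Proof.
elim: k i => [|k IH] i.
  rewrite /weight_pow expr0 mxE/= (inj_eq enum_val_inj).
  by rewrite (inj_eq (@cast_ord_inj _ _ _)).
rewrite exprS mxE /weight_pow iterS.
rewrite (reindex _ (onW_bij _ (enum_val_cast_bij e)))/=.
by apply: eq_bigr => m _; rewrite IH castmxE mxE.
Qed.

Lemma trace_weight_mx_pow n (e : #|V| = n.+1) k :
  \tr (castmx (e, e) (weight_mx q) ^+ k.+1) =
  \sum_(t : k.+1.-tuple V) path_weight q (val (tuple_loop t)).
Proof.
rewrite /mxtrace (eq_bigr _ (fun i _ => weight_mx_powE e k.+1 i i)).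
transitivity (\sum_x weight_pow k.+1 x x).
  by rewrite [RHS](reindex _ (onW_bij _ (enum_val_cast_bij e))).
under eq_bigr do rewrite weight_powE.
rewrite (exchange_big_dep xpredT)//=; apply: eq_bigr => t _.
rewrite (big_pred1 (tuple_root t))// => x; rewrite tuple_root_last.
by rewrite eq_sym.
Qed.

End WeightPower.

(** * The total mass of the loop measure *)

Lemma maxr0_subN (R : realDomainType) (x : R) :
  Num.max x 0 - Num.max (- x) 0 = x.
Proof.
case: (leP x 0) => x0; first by rewrite max_l ?oppr_ge0// sub0r opprK.
by rewrite max_r ?subr0// oppr_le0 ltW.
Qed.

Section RsumPartition.
Local Open Scope quotient_scope.
Local Open Scope classical_set_scope.
Local Open Scope ring_scope.
Variables (R : realType) (T : choiceType) (J : nat -> {fset T}) (rk : T -> nat).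
Hypothesis JE : forall k x, (x \in J k) = (rk x == k).

Lemma esum_partition (g : T -> R) S : (forall x, 0 <= g x) ->
  series (fun k => \sum_(x <- J k) g x) @ \oo --> S ->
  esum [set: T] (EFin \o g) = S%:E.
Proof.
move=> g0 gS.
have -> : [set: T] = \bigcup_k [set` J k].
  by apply/seteqP; split=> // x _; exists (rk x) => //=; rewrite JE.
rewrite nneseries_sum_bigcup; last 2 first.
- apply/trivIsetP => i j _ _ ij; apply/seteqP; split=> // x [/=].
  by rewrite !JE => /eqP -> /eqP ji; rewrite ji eqxx in ij.
- by move=> x; rewrite lee_fin.
have -> : (fun n => \sum_(0 <= i < n) esum [set` J i] (EFin \o g))%E =
  EFin \o series (fun k => \sum_(x <- J k) g x).
  apply/funext => n; rewrite /series/= -sumEFin; apply: eq_bigr => k _.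
  rewrite esum_fset//; last by move=> x _; rewrite lee_fin.
  by rewrite -fsbig_seq ?fset_uniq// sumEFin.
by rewrite EFin_lim ?(cvg_lim _ gS)//; apply/cvg_ex; exists S.
Qed.

(** Absolute convergence along the finite levels [J k] lets the positive and negative parts be
    summed separately, so the unordered sum is the series taken level by level. *)
Lemma rsum_partition (f : T -> R) :
  cvgn (series (fun k => \sum_(x <- J k) `|f x|)) ->
  series (fun k => \sum_(x <- J k) f x) @ \oo --> rsum [set: T] f.
Proof.
move=> cf.
have sub (g : T -> R) : (forall x, 0 <= g x <= `|f x|) ->
    cvgn (series (fun k => \sum_(x <- J k) g x)).
  move=> gf; apply: (series_le_cvg _ _ _ cf) => k.
  - by apply: sumr_ge0 => x _; case/andP: (gf x).
  - exact: sumr_ge0.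
  - by apply: ler_sum => x _; case/andP: (gf x).
pose p x := Num.max (f x) 0; pose n x := Num.max (- f x) 0.
have cp : cvgn (series (fun k => \sum_(x <- J k) p x)).
  by apply: sub => x; rewrite le_max lexx orbT ge_max ler_norm normr_ge0.
have cn : cvgn (series (fun k => \sum_(x <- J k) n x)).
  by apply: sub => x; rewrite le_max lexx orbT ge_max -normrN ler_norm normr_ge0.
have Ep : esum [set: T] ((EFin \o f)^\+)%E = (limn (series (fun k => \sum_(x <- J k) p x)))%:E.
  rewrite -(@esum_partition p)//; last by move=> x; rewrite le_max lexx orbT.
  by apply: eq_esum => x _; rewrite funeposE/= EFin_max.
have En : esum [set: T] ((EFin \o f)^\-)%E = (limn (series (fun k => \sum_(x <- J k) n x)))%:E.
  rewrite -(@esum_partition n)//; last by move=> x; rewrite le_max lexx orbT.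
  by apply: eq_esum => x _; rewrite funenegE/= EFin_max.
rewrite /rsum Ep En -EFinB/=.
have -> : series (fun k => \sum_(x <- J k) f x) =
  series (fun k => \sum_(x <- J k) p x) - series (fun k => \sum_(x <- J k) n x).
  rewrite -seriesN -seriesD; congr series; apply/funext => k.
  rewrite !fctE -sumrB; apply: eq_bigr => x _.
  by rewrite maxr0_subN.
exact: cvgB.
Qed.

End RsumPartition.

Section ComplexExp.
Local Open Scope quotient_scope.
Local Open Scope classical_set_scope.
Local Open Scope ring_scope.
Variable R : realType.
Local Notation C := R[i].

Lemma cexpD (z w : C) : cexp (z + w) = cexp z * cexp w.
Proof.
case: z w => [a b] [c d]; rewrite /cexp/= expRD cosD sinD.
by apply/eqP; rewrite eq_complex/=; apply/andP; split; apply/eqP; ring.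
Qed.

Lemma cexp0 : cexp (0 : C) = 1.
Proof. by rewrite /cexp/= expR0 cos0 sin0 mul1r. Qed.

Lemma cexp_sum (I : finType) (F : I -> C) : cexp (\sum_i F i) = \prod_i cexp (F i).
Proof.
apply: (big_ind2 (fun x y => cexp x = y)) => //; first exact: cexp0.
by move=> x1 x2 y1 y2 <- <-; exact: cexpD.
Qed.

Lemma Re_sum I (r : seq I) (P : pred I) (F : I -> C) :
  complex.Re (\sum_(i <- r | P i) F i) = \sum_(i <- r | P i) complex.Re (F i).
Proof. by apply: (big_morph _ _ (erefl _)) => -[? ?] [? ?]. Qed.

Lemma Im_sum I (r : seq I) (P : pred I) (F : I -> C) :
  complex.Im (\sum_(i <- r | P i) F i) = \sum_(i <- r | P i) complex.Im (F i).
Proof. by apply: (big_morph _ _ (erefl _)) => -[? ?] [? ?]. Qed.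

Lemma cvg_series_shift1 (f : nat -> R) (a : R) : f 0%N = 0 ->
  series f @ \oo --> a -> series (fun k => f k.+1) @ \oo --> a.
Proof.
move=> f0; rewrite -cvg_shiftS; apply: cvg_trans; apply: near_eq_cvg.
apply: nearW => n; rewrite /series/= big_nat_recl// f0 add0r.
by [].
Qed.

Lemma Re_norm_bound (z w : C) : `|z| <= w -> `|complex.Re z| <= complex.Re w.
Proof.
move=> zw; apply: Re_norm_le; rewrite RRe_real// ger0_real//.
exact: le_trans zw.
Qed.

Lemma Im_norm_bound (z w : C) : `|z| <= w -> `|complex.Im z| <= complex.Re w.
Proof.
move=> zw; apply: Im_norm_le; rewrite RRe_real// ger0_real//.
exact: le_trans zw.
Qed.
End ComplexExp.

Section LoopMass.
Local Open Scope quotient_scope.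
Local Open Scope classical_set_scope.
Local Open Scope ring_scope.
Variables (R : realType) (V : finType) (q : V -> V -> R[i]).
Local Notation C := R[i].
Local Notation absq := (fun x y => `|q x y|).
Local Notation unroot := (\pi_(unrooted_loop V)).

Lemma path_weight_norm w : `|path_weight q w| = path_weight absq w.
Proof. by rewrite /path_weight normr_prod. Qed.

Lemma loop_measure_norm_le (l : unrooted_loop V) :
  `|loop_measure q l| <= loop_measure absq l.
Proof.
have [k lk] : exists k, loop_length l = k.+1.
  by exists (loop_length l).-1; rewrite prednK// loop_length_gt0.
have [t lt] := tuple_loop_surj lk; rewrite -[l]reprK lt !loop_measureE.
rewrite (le_trans (ler_norm_sum _ _ _))// ler_sum// => s _.
by rewrite normrM normfV normr_nat path_weight_norm.
Qed.

Variables (n : nat) (e : #|V| = n.+1).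
Let Q : 'M[C]_n.+1 := castmx (e, e) (weight_mx q).

Lemma map_castmx_norm :
  map_mx Num.norm Q = castmx (e, e) (weight_mx absq).
Proof. by apply/matrixP => i j; rewrite mxE !castmxE !mxE. Qed.

Lemma castmx_integrable : integrable_weight q ->
  spectral_radius (map_mx Num.norm Q) < 1.
Proof.
rewrite /integrable_weight /Q; move: (weight_mx q); move: (#|V|) e => m em.
by subst m => M; rewrite castmx_id.
Qed.

Lemma castmx_det1B : \det (1%:M - Q) = \det (1%:M - weight_mx q).
Proof.
rewrite /Q; move: (weight_mx q); move: (#|V|) e => m em.
by subst m => M; rewrite castmx_id.
Qed.

Lemma sum_loop_measure k : \sum_(l <- loops_of_length V k) loop_measure q l =
  \tr (Q ^+ k.+1) / k.+1%:R.
Proof.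
rewrite trace_weight_mx_pow mulr_suml.
have := sum_loops_of_length q k (fun=> 1); under eq_bigr do rewrite mulr1.
by under [in RHS]eq_bigr do rewrite mulr1.
Qed.

End LoopMass.

Section LoopMassExp.
Local Open Scope quotient_scope.
Local Open Scope classical_set_scope.
Local Open Scope ring_scope.
Variables (R : realType) (V : finType) (q : V -> V -> R[i]).
Hypothesis q_integrable : integrable_weight q.
Local Notation C := R[i].
Local Notation absq := (fun x y => `|q x y|).
Variables (n : nat) (e : #|V| = n.+1).
Let Q : 'M[C]_n.+1 := castmx (e, e) (weight_mx q).

Lemma sum_norm_loop_measure_bound : exists r K : R, [/\ 0 < r < 1, 0 <= K &
  forall k, \sum_(l <- loops_of_length V k) `|loop_measure q l| <=
    (K * r ^+ k)%:C].
Proof.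
have [r [K [r01 K0 QK]]] := dominated_pow_bound (castmx_integrable e q_integrable).
have /andP[r0 r1] := r01.
(* The trace has [n.+1] entries, and the extra [r] appears because level [k] holds the loops of
   length [k + 1]. *)
exists r, (n.+1%:R * K * r); split=> //.
  by rewrite !mulr_ge0// ltW.
move=> k; apply: le_trans (ler_sum _ (fun l _ => loop_measure_norm_le q l)) _.
rewrite (sum_loop_measure _ e) -map_castmx_norm.
have tr0 : 0 <= \tr (map_mx Num.norm Q ^+ k.+1).
  by apply: sumr_ge0 => i _; apply: le_trans (expmx_norm_le _ _ _ _).
apply: (@le_trans _ _ (\tr (map_mx Num.norm Q ^+ k.+1))).
  by rewrite ler_pdivrMr ?ltr0n// ler_peMr// ler1n.
apply: (@le_trans _ _ (\sum_(i < n.+1) (K * r ^+ k.+1)%:C)).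
  exact: ler_sum.
by rewrite sumr_const card_ord -rmorphMn/= -mulr_natl exprS !mulrA.
Qed.

(** The geometric bound makes the loop measure absolutely summable by length, so the unordered total
    mass is a series of traces. *)
Lemma loop_mass_cvg :
  series (fun k => complex.Re (\tr (Q ^+ k.+1) / k.+1%:R)) @ \oo -->
    complex.Re (loop_mass q) /\
  series (fun k => complex.Im (\tr (Q ^+ k.+1) / k.+1%:R)) @ \oo -->
    complex.Im (loop_mass q).
Proof.
have [r [K [/andP[r0 r1] K0 mK]]] := sum_norm_loop_measure_bound.
have gK : cvgn (series (geometric K r)).
  by apply: is_cvg_geometric_series; rewrite gtr0_norm.
have bound (f : unrooted_loop V -> R) :
    (forall l, `|f l| <= complex.Re `|loop_measure q l|) ->
    cvgn (series (fun k => \sum_(l <- loops_of_length V k) `|f l|)).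
  move=> fm; apply: (series_le_cvg _ _ _ gK) => k.
  - exact: sumr_ge0.
  - by rewrite /= mulr_ge0// exprn_ge0// ltW.
  - apply: le_trans (ler_sum _ (fun l _ => fm l)) _.
    by rewrite -Re_sum; have := mK k; rewrite lecE => /andP[_].
split.
- have -> : (fun k => complex.Re (\tr (Q ^+ k.+1) / k.+1%:R)) =
    (fun k => \sum_(l <- loops_of_length V k) complex.Re (loop_measure q l)).
    by apply/funext => k; rewrite -sum_loop_measure Re_sum.
  apply: (rsum_partition (@mem_loops_of_length_pred V)).
  by apply: bound => l; exact: Re_norm_bound.
- have -> : (fun k => complex.Im (\tr (Q ^+ k.+1) / k.+1%:R)) =
    (fun k => \sum_(l <- loops_of_length V k) complex.Im (loop_measure q l)).
    by apply/funext => k; rewrite -sum_loop_measure Im_sum.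
  apply: (rsum_partition (@mem_loops_of_length_pred V)).
  by apply: bound => l; exact: Im_norm_bound.
Qed.

Lemma series_sum (I : finType) (F : I -> nat -> R) (A : I -> R) :
  (forall i, series (F i) @ \oo --> A i) ->
  series (fun k => \sum_i F i k) @ \oo --> \sum_i A i.
Proof.
move=> FA; have -> : series (fun k => \sum_i F i k) = fun N => \sum_i series (F i) N.
  by apply/funext => N; rewrite /series/= exchange_big.
elim: (index_enum I) => [|i s IH].
  by under eq_fun do rewrite big_nil; rewrite big_nil; exact: cvg_cst.
by under eq_fun do rewrite big_cons; rewrite big_cons; exact: cvgD (FA i) IH.
Qed.

Lemma cexp_loop_mass : cexp (- loop_mass q) = \det (1%:M - weight_mx q).
Proof.
have [l [lQ trQ detQ]] := spectrum_trace_det Q.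
have log i : exists AB : R * R,
  [/\ series (fun k => complex.Re (l i ^+ k.+1 / k.+1%:R)) @ \oo --> AB.1,
      series (fun k => complex.Im (l i ^+ k.+1 / k.+1%:R)) @ \oo --> AB.2 &
      cexp (- (AB.1 +i* AB.2)) = 1 - l i].
  have l1 := dominated_eigenvalue_lt1 (castmx_integrable e q_integrable) (lQ i).
  (* The midpoint of [|l i|] and 1 is positive even when [l i = 0]. *)
  pose r := (complex.Re `|l i| + 1) / 2.
  have l0 : 0 <= complex.Re `|l i| by rewrite -ler0c -normCE.
  have {}l1 : complex.Re `|l i| < 1 by rewrite -ltcR -normCE.
  have r01 : 0 < r < 1 by rewrite /r; apply/andP; split; lra.
  have lr : `|l i| <= r%:C by rewrite normCE lecR /r; lra.
  have [A [B [hA hB hAB]]] := cexp_log_series r01 lr.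
  exists (A, B); split=> //=.
    (* The logarithm series starts at [k = 0] with a zero term, so the shift by one keeps its
       sum. *)
    by apply: (cvg_series_shift1 _ hA); rewrite invr0 mulr0.
  by apply: (cvg_series_shift1 _ hB); rewrite invr0 mulr0.
have [AB hAB] := choice log.
have [mR mI] := loop_mass_cvg.
have -> : loop_mass q = \sum_i ((AB i).1 +i* (AB i).2).
  have trE k : \tr (Q ^+ k.+1) / k.+1%:R = \sum_i (l i ^+ k.+1 / k.+1%:R).
    by rewrite trQ mulr_suml.
  have ER : (fun k => complex.Re (\tr (Q ^+ k.+1) / k.+1%:R)) =
      (fun k => \sum_i complex.Re (l i ^+ k.+1 / k.+1%:R)).
    by apply/funext => k; rewrite trE Re_sum.
  have EI : (fun k => complex.Im (\tr (Q ^+ k.+1) / k.+1%:R)) =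
      (fun k => \sum_i complex.Im (l i ^+ k.+1 / k.+1%:R)).
    by apply/funext => k; rewrite trE Im_sum.
  rewrite ER in mR; rewrite EI in mI.
  apply/eqP; rewrite eq_complex Re_sum Im_sum; apply/andP; split; apply/eqP.
    by apply: cvg_unique mR _ => //; apply: series_sum => i; have [] := hAB i.
  by apply: cvg_unique mI _ => //; apply: series_sum => i; have [] := hAB i.
rewrite -sumrN cexp_sum -(castmx_det1B q e) detQ.
by apply: eq_bigr => i _; have [] := hAB i.
Qed.

End LoopMassExp.

(** * Soups with a given current *)

Section FiniteCsum.
Local Open Scope quotient_scope.
Local Open Scope classical_set_scope.
Local Open Scope fset_scope.
Local Open Scope ring_scope.
Variables (R : realType) (T : choiceType) (D : set T).
Hypothesis finD : finite_set D.

Lemma rsum_finite (f : T -> R) : rsum D f = \sum_(x \in D) f x.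
Proof.
rewrite /rsum !esum_fset//.
rewrite !fsbig_finite//.
under eq_bigr do rewrite funeposE/= -EFin_max.
under [X in (_ - X)%E]eq_bigr do rewrite funenegE/= -EFin_max.
rewrite !sumEFin -EFinB/= -sumrB; apply: eq_bigr => x _.
by rewrite maxr0_subN.
Qed.

Lemma csum_finite (f : T -> R[i]) : csum D f = \sum_(x \in D) f x.
Proof.
rewrite /csum !rsum_finite !fsbig_finite//.
by elim/big_ind3 : _ => //= [[? ?] ? ? [? ?] ? ? [-> ->] [-> ->] //|x _]; case: (f x).
Qed.

End FiniteCsum.

Section Soups.
Local Open Scope quotient_scope.
Local Open Scope classical_set_scope.
Local Open Scope fset_scope.
Local Open Scope ring_scope.
Variable V : finType.
Local Notation L := (unrooted_loop V).
Local Notation current := (V -> V -> nat).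
Implicit Types (s : soup V) (l : L) (C : current).

Definition current_size C := (\sum_u \sum_v C u v)%N.
Definition current_le (C D : current) := [forall u, forall v, (C u v <= D u v)%N].
(** Truncated subtraction: a genuine difference only under [current_le D C]. *)
Definition current_sub (C D : current) : current := fun u v => (C u v - D u v)%N.

Lemma current_leP (C D : current) : reflect (forall u v, (C u v <= D u v)%N) (current_le C D).
Proof.
apply: (iffP forallP) => [h u v|h u]; first by have /forallP := h u.
exact/forallP.
Qed.

Lemma current_size_le (C D : current) : current_le C D -> (current_size C <= current_size D)%N.
Proof. by move=> /current_leP CD; apply: leq_sum => u _; apply: leq_sum. Qed.

Lemma current_size_sub (C D : current) : current_le D C ->
  current_size (current_sub C D) = (current_size C - current_size D)%N.
Proof.
move=> /current_leP DC; rewrite /current_size -sumnB => [|u _]; last exact: leq_sum.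
by apply: eq_bigr => u _; rewrite -sumnB.
Qed.

Lemma current_size_loop l : current_size (loop_edge_count l) = loop_length l.
Proof. exact: loop_edges_total. Qed.

Lemma soup_currentE s (A : {fset L}) u v : finsupp s `<=` A ->
  soup_current s u v = (\sum_(l <- A) s l * loop_edge_count l u v)%N.
Proof.
move=> sA; rewrite /soup_current (big_fset_incl _ sA)// => l _ ls.
by rewrite fsfun_dflt.
Qed.

Lemma loop_le_soup s l : l \in finsupp s -> current_le (loop_edge_count l) (soup_current s).
Proof.
move=> ls; apply/current_leP => u v; rewrite /soup_current (big_fsetD1 l)//=.
by rewrite (leq_trans _ (leq_addr _ _))// leq_pmull// lt0n -mem_finsupp.
Qed.

(** Every loop has an edge, so each copy costs at least one unit of current; this bounds the
    multiplicities in [finite_soups_with]. *)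
Lemma soup_mult_le s l : (s l <= current_size (soup_current s))%N.
Proof.
have [ls|ls] := boolP (l \in finsupp s); last by rewrite fsfun_dflt.
apply: (@leq_trans (s l * current_size (loop_edge_count l))).
  by rewrite leq_pmulr// current_size_loop; exact: path_length_gt0.
rewrite /current_size big_distrr/=; apply: leq_sum => u _.
rewrite big_distrr/=; apply: leq_sum => v _.
by rewrite /soup_current (big_fsetD1 l)//= leq_addr.
Qed.

Definition soups_with C : set (soup V) := [set s | soup_current s = C].

Lemma finite_loops N : finite_set [set l : L | (loop_length l <= N)%N].
Proof.
apply: (@sub_finite_set _ _ (\bigcup_(k in `I_N) [set` loops_of_length V k])).
  move=> l /= lN; have l0 := loop_length_gt0 l.
  by exists (loop_length l).-1 => /=; [lia|rewrite mem_loops_of_length prednK].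
by apply: bigcup_finite => // k _; exact: finite_fset.
Qed.

(** With [N] the size of [C], such a soup contains only loops of length at most [N], each at most
    [N] times, and so comes from a function between finite types. *)
Lemma finite_soups_with C : finite_set (soups_with C).
Proof.
pose N := current_size C; pose A := fset_set [set l : L | (loop_length l <= N)%N].
pose g (f : {ffun A -> 'I_N.+1}) : soup V := [fsfun x : A => nat_of_ord (f x)].
apply: (@sub_finite_set _ _ (g @` setT)%classic); last first.
  by apply: finite_image; exact: finite_finset.
move=> s sC; exists [ffun x : A => inord (s (val x))] => //.
apply/fsfunP => l; rewrite fsfun_ffun.
case: insubP => [x lA <-|lA] /=.
  rewrite ffunE inordK// ltnS; have := soup_mult_le s (val x).
  by rewrite sC.
rewrite fsfun_dflt//; apply: contra lA => ls.
rewrite in_fset_set; last exact: finite_loops.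
rewrite inE/= -current_size_loop /N -sC; apply: current_size_le.
exact: loop_le_soup.
Qed.

Definition soup_add l s : soup V := [fsfun s with l |-> (s l).+1].
Definition soup_remove l s : soup V := [fsfun s with l |-> (s l).-1].

Lemma soup_addE l s x : soup_add l s x = ((x == l) + s x)%N.
Proof. by rewrite fsfun_withE; case: eqP => [->|]. Qed.

Lemma soup_removeK l s : (0 < s l)%N -> soup_add l (soup_remove l s) = s.
Proof.
move=> sl; apply/fsfunP => x; rewrite soup_addE fsfun_withE.
by case: eqP => [->|//]; rewrite add1n prednK.
Qed.

Lemma soup_add_inj l : injective (soup_add l).
Proof.
move=> s s' ss'; apply/fsfunP => x.
by have := congr1 (fun f : soup V => f x) ss'; rewrite !soup_addE => /addnI.
Qed.

Lemma finsupp_soup_add l s : finsupp (soup_add l s) `<=` l |` finsupp s.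
Proof. by rewrite finsupp_with; apply/fsubsetP => x. Qed.

Lemma soup_current_add l s u v :
  soup_current (soup_add l s) u v = (loop_edge_count l u v + soup_current s u v)%N.
Proof.
rewrite (soup_currentE u v (finsupp_soup_add l s)).
rewrite (soup_currentE u v (fsubsetU1 l (finsupp s))).
rewrite (big_fsetD1 l)/= ?fset1U1// [in RHS](big_fsetD1 l)/= ?fset1U1//.
rewrite soup_addE eqxx mulnDl mul1n -addnA; congr (_ + (_ + _))%N.
by apply: eq_big_seq => x; rewrite !inE => /andP[/negPf xl _]; rewrite soup_addE xl.
Qed.

End Soups.

(** * The loop removal recursion for soups *)

Section SoupWeight.
Local Open Scope quotient_scope.
Local Open Scope classical_set_scope.
Local Open Scope fset_scope.
Local Open Scope ring_scope.
Variables (R : realType) (V : finType) (q : V -> V -> R[i]).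
Local Notation L := (unrooted_loop V).
Local Notation K := R[i].
Local Notation current := (V -> V -> nat).
Implicit Types (s : soup V) (l : L) (C : current).

(** [soup_measure] without its normalizing factor [exp (- m(L))]. *)
Definition soup_weight s : K :=
  \prod_(l <- finsupp s) (loop_measure q l ^+ s l / ((s l)`!)%:R).

Definition current_mass C : K := \sum_(s \in soups_with C) soup_weight s.

Lemma soup_weightE s (A : {fset L}) : finsupp s `<=` A ->
  soup_weight s = \prod_(l <- A) (loop_measure q l ^+ s l / ((s l)`!)%:R).
Proof.
move=> sA; rewrite /soup_weight (big_fset_incl _ sA)// => l _ ls.
by rewrite fsfun_dflt// fact0 expr0 divr1.
Qed.

(** The Poisson identity [(j + 1) m^(j+1) / (j+1)! = m m^j / j!] in the factor at [l]; the other
    factors do not change. *)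
Lemma soup_weight_add l s :
  (soup_add l s l)%:R * soup_weight (soup_add l s) = loop_measure q l * soup_weight s.
Proof.
rewrite (soup_weightE (finsupp_soup_add l s)) (soup_weightE (fsubsetU1 l (finsupp s))).
rewrite (big_fsetD1 l)/= ?fset1U1// [in RHS](big_fsetD1 l)/= ?fset1U1//.
rewrite !mulrA; congr (_ * _); last first.
  by apply: eq_big_seq => x; rewrite !inE => /andP[/negPf xl _]; rewrite soup_addE xl.
rewrite soup_addE eqxx add1n factS natrM exprS invfM.
have n0 : ((s l).+1%:R : K) != 0 by rewrite pnatr_eq0.
have cancel (a b c d : K) : a != 0 -> a * (b * c) * (a^-1 * d) = b * c * d.
  by move=> a0; field.
exact: cancel.
Qed.

(** Soups without [l] contribute 0. Adding [l] is a bijection from the soups with current [C - c(l)]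
    onto the others, and [soup_weight_add] gives the weights. *)
Lemma current_mass_remove_loop C l :
  \sum_(s \in soups_with C) (s l)%:R * soup_weight s =
  loop_measure q l * (if current_le (loop_edge_count l) C
    then current_mass (current_sub C (loop_edge_count l)) else 0).
Proof.
case: ifPn => [lC|lC]; last first.
  rewrite mulr0 fsbig1// => s sC.
  rewrite fsfun_dflt ?mul0r//; apply: contra lC => ls.
  by rewrite -sC; exact: loop_le_soup.
rewrite mulr_fsumr.
transitivity (\sum_(s \in (soups_with C `&` [set s : soup V | (0 < s l)%N])%classic)
    (s l)%:R * soup_weight s).
  apply/esym/fsbig_widen => [s []//|s [sC /= /not_andP[//|/negP]]].
  by rewrite -eqn0Ngt => /eqP ->; rewrite mul0r.
rewrite (reindex_fsbig (soup_add l) (soups_with (current_sub C (loop_edge_count l)))).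
  by apply: eq_fsbigr => s _; exact: soup_weight_add.
split.
- move=> s /= sC; split; last by rewrite soup_addE eqxx.
  apply/funext => u; apply/funext => v; rewrite soup_current_add sC /current_sub.
  by rewrite subnKC//; exact: (current_leP _ _ lC).
- by move=> s s' _ _ /soup_add_inj.
move=> s [/= sC sl]; exists (soup_remove l s); last exact: soup_removeK.
apply/funext => u; apply/funext => v; rewrite /current_sub -sC.
by rewrite -[in RHS](soup_removeK sl) soup_current_add addKn.
Qed.

(** The in-degree splits over the loops of the soup, grouped by length. No loop of the soup is
    longer than the size of [C], so [N] levels suffice. *)
Lemma current_indegreeE C s N u : soup_current s = C -> (current_size C <= N)%N ->
  (\sum_v C v u = \sum_(k < N) \sum_(l <- loops_of_length V k)
     s l * \sum_v loop_edge_count l v u)%N.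
Proof.
move=> sC CN; rewrite -[in LHS]sC /soup_current exchange_big/=.
under eq_bigr do rewrite -big_distrr/=.
pose X l := (s l * \sum_v loop_edge_count l v u)%N.
have lenP l : l \in finsupp s -> ((loop_length l).-1 < N)%N.
  move=> /loop_le_soup/current_size_le; rewrite sC current_size_loop.
  by have := loop_length_gt0 l; lia.
transitivity (\sum_(l <- finsupp s) \sum_(k < N | (loop_length l).-1 == k) X l)%N.
  by apply: eq_big_seq => l /lenP lN; rewrite (big_pred1 (Ordinal lN)).
rewrite (exchange_big_dep xpredT)//=; apply: eq_bigr => k _.
rewrite big_fset_condE/= (@big_fset_incl _ _ _ _ _ (loops_of_length V k))//.
  by apply/fsubsetP => l; rewrite !inE/= mem_loops_of_length_pred => /andP[].
move=> l; rewrite mem_loops_of_length_pred !inE/= => -> /=; rewrite andbT => ls.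
by rewrite /X fsfun_dflt.
Qed.

(** The in-degree at [u] is expanded over the loops of each soup; for each loop one copy is removed,
    and the rotation average turns the unrooted loops into loops rooted at [u]. *)
Lemma current_mass_euler C N u : (current_size C <= N)%N ->
  (\sum_v C v u)%:R * current_mass C =
  \sum_(k < N) \sum_(t : k.+1.-tuple V | tuple_root t == u)
    path_weight q (tuple_root t :: t) *
    (if current_le (edge_count (tuple_root t :: t)) C
     then current_mass (current_sub C (edge_count (tuple_root t :: t))) else 0).
Proof.
move=> CN; rewrite mulr_fsumr.
transitivity (\sum_(s \in soups_with C) \sum_(k < N) \sum_(l <- loops_of_length V k)
    (\sum_v loop_edge_count l v u)%:R * ((s l)%:R * soup_weight s)).
  apply: eq_fsbigr => s; rewrite inE => sC.
  rewrite (current_indegreeE u sC CN) natr_sum mulr_suml; apply: eq_bigr => k _.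
  rewrite natr_sum mulr_suml; apply: eq_bigr => l _.
  by rewrite natrM mulrAC mulrC.
rewrite fsbig_finite; last exact: finite_soups_with.
rewrite exchange_big/=; apply: eq_bigr => k _; rewrite exchange_big/=.
under eq_bigr do rewrite -mulr_sumr -(fsbig_finite _ _ (finite_soups_with C))
  current_mass_remove_loop.
rewrite (sum_loops_indegree q k (fun l => if current_le (loop_edge_count l) C
  then current_mass (current_sub C (loop_edge_count l)) else 0)).
by apply: eq_bigr => t _; rewrite edge_count_pi.
Qed.

End SoupWeight.

(** * The multinomial weight of a current *)

Section Flows.
Variable V : finType.
Local Notation current := (V -> V -> nat).
Implicit Types C : current.

Definition outdeg C u := (\sum_v C u v)%N.
Definition indeg C u := (\sum_v C v u)%N.
Definition edge (x y : V) : current := fun a b => ((a, b) == (x, y)) : nat.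

Lemma outdeg_edge x y a : outdeg (edge x y) a = (a == x).
Proof.
rewrite /outdeg (bigD1 y)//= big1 ?addn0 => [|b /negPf yb]; rewrite /edge xpair_eqE.
  by rewrite eqxx andbT.
by rewrite yb andbF.
Qed.

Lemma indeg_edge x y a : indeg (edge x y) a = (a == y).
Proof.
rewrite /indeg (bigD1 x)//= big1 ?addn0 => [|b /negPf xb]; rewrite /edge xpair_eqE.
  by rewrite eqxx.
by rewrite xb.
Qed.

Lemma outdeg_sub C D a : current_le D C ->
  outdeg (current_sub C D) a = (outdeg C a - outdeg D a)%N.
Proof. by move=> /current_leP DC; rewrite /outdeg sumnB. Qed.

Lemma indeg_sub C D a : current_le D C ->
  indeg (current_sub C D) a = (indeg C a - indeg D a)%N.
Proof. by move=> /current_leP DC; rewrite /indeg sumnB. Qed.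

Lemma outdeg_le C D a : current_le D C -> (outdeg D a <= outdeg C a)%N.
Proof. by move=> /current_leP DC; apply: leq_sum. Qed.

Lemma indeg_le C D a : current_le D C -> (indeg D a <= indeg C a)%N.
Proof. by move=> /current_leP DC; apply: leq_sum. Qed.

Lemma edge_leE C x y : current_le (edge x y) C = (0 < C x y)%N.
Proof.
apply/current_leP/idP => [/(_ x y)|C0 a b]; first by rewrite /edge eqxx.
by rewrite /edge; case: eqP => // -[-> ->].
Qed.

Lemma edge_count_cons (x y : V) p a b :
  edge_count (x :: y :: p) a b = (edge x y a b + edge_count (y :: p) a b)%N.
Proof. by rewrite /edge_count /path_edges/= /edge eq_sym. Qed.

Lemma path_flow (x : V) p a :
  (outdeg (edge_count (x :: p)) a + (a == last x p) =
   indeg (edge_count (x :: p)) a + (a == x))%N.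
Proof.
elim: p x => [|y p IH] x.
  by rewrite /outdeg /indeg !big1.
have -> : outdeg (edge_count (x :: y :: p)) a =
    ((a == x) + outdeg (edge_count (y :: p)) a)%N.
  rewrite -(outdeg_edge x y) /outdeg -big_split.
  by apply: eq_bigr => b _; rewrite edge_count_cons.
have -> : indeg (edge_count (x :: y :: p)) a =
    ((a == y) + indeg (edge_count (y :: p)) a)%N.
  rewrite -(indeg_edge x y) /indeg -big_split.
  by apply: eq_bigr => b _; rewrite edge_count_cons.
have := IH y; rewrite /=; lia.
Qed.

Lemma current_le_cons C x y p :
  current_le (edge_count (x :: y :: p)) C =
  (0 < C x y)%N && current_le (edge_count (y :: p)) (current_sub C (edge x y)).
Proof.
rewrite -edge_leE; apply/current_leP/andP => [h|[/current_leP h1 /current_leP h2] a b].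
  by split; apply/current_leP => a b; have := h a b; rewrite edge_count_cons /current_sub; lia.
by have := h1 a b; have := h2 a b; rewrite edge_count_cons /current_sub; lia.
Qed.

Lemma current_sub_cons C x y p :
  current_sub C (edge_count (x :: y :: p)) =
  current_sub (current_sub C (edge x y)) (edge_count (y :: p)).
Proof.
by apply/funext => a; apply/funext => b; rewrite /current_sub edge_count_cons subnDA.
Qed.

(** A unit flow from [x] to [u], stated additively to avoid truncated subtraction; for [x = u] it is
    a balanced current. *)
Definition flow C x u :=
  forall a, (outdeg C a + (a == u) = indeg C a + (a == x))%N.

Lemma flow_sub_edge C x y u : (0 < C x y)%N -> flow C x u ->
  flow (current_sub C (edge x y)) y u.
Proof.
rewrite -edge_leE => le fl a; rewrite outdeg_sub// indeg_sub//.
have := outdeg_le a le; have := indeg_le a le; have := fl a.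
by rewrite outdeg_edge indeg_edge; lia.
Qed.

Lemma current_size_edge x y : current_size (edge x y) = 1%N.
Proof.
rewrite [LHS](eq_bigr _ (fun a _ => outdeg_edge x y a)) (bigD1 x)//= eqxx.
by rewrite big1 // => a /negPf ->.
Qed.

Lemma current_size_eq0 C : current_size C = 0%N -> C = fun _ _ => 0%N.
Proof.
move=> /eqP; rewrite sum_nat_eq0 => /forallP C0; apply/funext => a; apply/funext => b.
by have := C0 a; rewrite sum_nat_eq0 => /forallP/(_ b)/eqP.
Qed.

End Flows.

Section Multinomial.
Variables (R : realType) (V : finType) (q : V -> V -> R[i]).
Local Notation K := R[i].
Local Notation current := (V -> V -> nat).
Implicit Types C : current.

(** The out-degree stands in for [current_degree]: the induction passes through flows that are not
    balanced. *)
Definition vertex_weight C u : K :=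
  (\prod_v q u v ^+ C u v) * ((outdeg C u)`!)%:R / (\prod_v (C u v)`!)%N%:R.

Definition multinomial C : K := \prod_u vertex_weight C u.

(** Only the factor at [x] changes: it loses one [q x y], and both the out-degree of [x] and [C x y]
    drop by one inside their factorials. *)
Lemma multinomial_sub_edge C x y : (0 < C x y)%N ->
  q x y * multinomial (current_sub C (edge x y)) * (outdeg C x)%:R =
  (C x y)%:R * multinomial C.
Proof.
move=> Cxy; have le : current_le (edge x y) C by rewrite edge_leE.
rewrite /multinomial (bigD1 x)//= [in RHS](bigD1 x)//=.
have -> : \prod_(u | u != x) vertex_weight (current_sub C (edge x y)) u =
          \prod_(u | u != x) vertex_weight C u.
  apply: eq_bigr => u /negPf ux; rewrite /vertex_weight outdeg_sub// outdeg_edge ux subn0.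
  have E v : current_sub C (edge x y) u v = C u v.
    by rewrite /current_sub /edge xpair_eqE ux subn0.
  by congr (_ * _ / _%:R); apply: eq_bigr => v _; rewrite E.
set P := \prod_(u | u != x) _.
rewrite mulrA mulrAC !mulrA; congr (_ * _).
have E v : v != y -> current_sub C (edge x y) x v = C x v.
  by move=> /negPf vy; rewrite /current_sub /edge xpair_eqE vy andbF subn0.
have Ey : current_sub C (edge x y) x y = (C x y).-1.
  by rewrite /current_sub /edge eqxx subn1.
rewrite /vertex_weight outdeg_sub// outdeg_edge eqxx subn1.
have o0 : (0 < outdeg C x)%N by rewrite (leq_trans Cxy)// /outdeg (bigD1 y)//= leq_addr.
rewrite (bigD1 y)//= Ey (eq_bigr (fun v => q x v ^+ C x v)) => [|v vy]; last by rewrite E.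
rewrite [X in X%:R^-1](bigD1 y)//= Ey.
rewrite (eq_bigr (fun v => (C x v)`!)) => [|v vy]; last by rewrite E.
rewrite [in RHS](bigD1 y)//= [X in _ = _ / X%:R](bigD1 y)//=.
move: o0 Cxy; case: (outdeg C x) => // o _; case: (C x y) => // c _ /=.
rewrite !factS exprS !natrM.
set A := \prod_(v | v != y) _; set B := (\prod_(v | v != y) _)%N%:R.
have c0 : (c.+1%:R : K) != 0 by rewrite pnatr_eq0.
have f0 : (c`!%:R : K) != 0 by rewrite pnatr_eq0 -lt0n fact_gt0.
have B0 : B != 0.
  by rewrite pnatr_eq0 -lt0n prodn_gt0// => v; rewrite fact_gt0.
have key (Q Qc o1 o' c1 c' a b : K) : c1 != 0 -> c' != 0 -> b != 0 ->
  Q * (Qc * a) * o' / (c' * b) * o1 = c1 * (Q * Qc * a) * (o1 * o') / (c1 * c' * b).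
  by move=> *; field; do ?[apply/andP; split].
exact: key.
Qed.

(** Pascal's rule, splitting by the first exit from [x]: [multinomial_sub_edge] is summed over [v],
    and the [C x v] add up to the out-degree. *)
Lemma multinomial_pascal C x : (0 < outdeg C x)%N ->
  multinomial C = \sum_v (if (0 < C x v)%N
    then q x v * multinomial (current_sub C (edge x v)) else 0).
Proof.
move=> o0; have oN0 : ((outdeg C x)%:R : K) != 0 by rewrite pnatr_eq0 -lt0n.
apply: (mulIf oN0); rewrite mulr_suml.
transitivity (\sum_v (C x v)%:R * multinomial C).
  by rewrite -mulr_suml -natr_sum mulrC.
apply: eq_bigr => v _; case: ifPn => [/multinomial_sub_edge -> //|].
by rewrite -eqn0Ngt => /eqP ->; rewrite !mul0r.
Qed.

(** The part of the recursion carried by the paths of length [k] from [x] to [u]. Open paths are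
    allowed so that the first step can be split off. *)
Definition path_sum (G : current -> K) u k x C : K :=
  \sum_(t : k.-tuple V | last x t == u) path_weight q (x :: t) *
    (if current_le (edge_count (x :: t)) C
     then G (current_sub C (edge_count (x :: t))) else 0).

Lemma path_sum0 G u x C : path_sum G u 0 x C = (x == u)%:R * G C.
Proof.
rewrite /path_sum big_mkcond (big_pred1 [tuple]) => [|t]; last by rewrite [t]tuple0 /= eqxx.
have -> : current_le (edge_count [:: x]) C by apply/current_leP.
have -> : current_sub C (edge_count [:: x]) = C.
  by apply/funext => a; apply/funext => b; exact: subn0.
by rewrite /path_weight big_nil mul1r /=; case: eqP; rewrite ?mul1r ?mul0r.
Qed.

Lemma path_sumS G u k x C : path_sum G u k.+1 x C =
  \sum_v (if (0 < C x v)%N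
    then q x v * path_sum G u k v (current_sub C (edge x v)) else 0).
Proof.
rewrite /path_sum big_mkcond big_tuple_cons; apply: eq_bigr => v _.
rewrite -big_mkcond/=.
under eq_bigr do rewrite current_le_cons current_sub_cons path_weight_cons.
case: ifPn => Cv /=; last by rewrite big1// => t _; rewrite mulr0.
by rewrite mulr_sumr; apply: eq_bigr => t _; rewrite mulrA.
Qed.

(* A walk from x that pops the stacks of exits of C stops at u, at its
   (outdeg C u + 1)-st visit to u. *)
Lemma path_sum_multinomial N u x C : flow C x u -> (current_size C <= N)%N ->
  \sum_(k < N.+1) path_sum multinomial u k x C = (outdeg C u).+1%:R * multinomial C.
Proof.
elim: N x C => [|N IH] x C fl CN.
  (* The zero matrix is a flow from [x] to [u] only when [x = u], and then only the trivial path
     counts. *)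
  have C0 : C = fun _ _ => 0%N by apply: current_size_eq0; apply/eqP; rewrite -leqn0.
  have o0 a : outdeg C a = 0%N by rewrite C0 /outdeg big1.
  have i0 a : indeg C a = 0%N by rewrite C0 /indeg big1.
  have := fl u; rewrite o0 i0 eqxx big_ord1 path_sum0 => E.
  by have -> : x == u by rewrite eq_sym; case: (u == x) E.
rewrite big_ord_recl/= path_sum0.
(* After a first step to [v] the rest is a smaller flow from [v] to [u]. The step uses an exit of
   [u] exactly when [x = u], hence the subtracted term. *)
have -> : \sum_(i < N.+1) path_sum multinomial u (bump 0 i) x C =
    \sum_v (if (0 < C x v)%N then
      (outdeg C u - (u == x)).+1%:R * (q x v * multinomial (current_sub C (edge x v))) else 0).
  under eq_bigr do rewrite /bump/= add1n path_sumS.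
  rewrite exchange_big/=; apply: eq_bigr => v _; case: ifPn => Cv; last by rewrite big1.
  rewrite -mulr_sumr IH; last 2 first.
  - exact: flow_sub_edge.
  - by rewrite current_size_sub ?edge_leE// current_size_edge; lia.
  by rewrite outdeg_sub ?edge_leE// outdeg_edge mulrCA.
(* Without an exit from [x], the flow equation at [x] forces [x = u] and no path leaves. *)
have [o0|o0] := posnP (outdeg C x).
  move: (o0); have -> : x = u.
    by apply/eqP; have := fl x; rewrite o0 eqxx; case: (x == u) => //; lia.
  move=> {}o0; rewrite eqxx mul1r o0 big1 ?addr0 ?mul1r// => v _.
  have -> : C u v = 0%N; last by [].
  by apply/eqP; rewrite -leqn0 -o0 /outdeg (bigD1 v)//= leq_addr.
have -> : \sum_v (if (0 < C x v)%N then (outdeg C u - (u == x)).+1%:R *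
      (q x v * multinomial (current_sub C (edge x v))) else 0) =
    (outdeg C u - (u == x)).+1%:R * multinomial C.
  rewrite (multinomial_pascal o0) mulr_sumr; apply: eq_bigr => v _.
  by case: ifP => // _; rewrite mulr0.
(* For [x = u] the trivial path restores the exit spent by the first step; the subtraction is exact
   because the out-degree is positive. *)
rewrite eq_sym; case: eqP => [xu|_]; last by rewrite mul0r add0r subn0.
by rewrite -xu in o0; rewrite -mulrDl -natrD; congr (_%:R * _); lia.
Qed.

End Multinomial.

(** * Identification of the two weights *)

Section CurrentField.
Local Open Scope quotient_scope.
Local Open Scope ring_scope.
Variables (R : realType) (V : finType) (q : V -> V -> R[i]).
Local Notation K := R[i].
Local Notation current := (V -> V -> nat).
Implicit Types C : current.

Lemma current_mass0 : current_mass q (fun _ _ => 0%N) = 1.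
Proof.
rewrite /current_mass (_ : soups_with _ = [set ([fsfun] : soup V)]%classic).
  by rewrite fsbig_set1 /soup_weight finsupp0 big_seq_fset0.
apply/seteqP; split=> s /=; last first.
  move=> ->; apply/funext => u; apply/funext => v.
  by rewrite /soup_current finsupp0 big_seq_fset0.
move=> s0; apply/fsfunP => l; rewrite fsfun0E; apply/eqP; rewrite -leqn0.
by have := soup_mult_le s l; rewrite s0 /current_size big1// => u _; rewrite big1.
Qed.

Lemma current_mass_multinomial C : is_current C ->
  current_mass q C = multinomial q C.
Proof.
have [N] := ubnP (current_size C); elim: N C => // N IH C CN Cc.
have [C0|C0] := posnP (current_size C).
  rewrite (current_size_eq0 C0) current_mass0 /multinomial big1// => u _.
  by rewrite /vertex_weight /outdeg !big1// mul1r divr1.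
(* The recursion at [u] determines the mass only after division by the in-degree of [u]. *)
have [u Cu] : exists u, (0 < indeg C u)%N.
  apply/existsP; apply: contraLR C0 => /existsPn Ci.
  rewrite -eqn0Ngt /current_size exchange_big/= sum_nat_eq0.
  by apply/forallP => u; have := Ci u; rewrite -eqn0Ngt.
have out_in a : outdeg C a = indeg C a by exact: Cc.
have i0 : ((indeg C u)%:R : K) != 0 by rewrite pnatr_eq0 -lt0n.
apply: (mulfI i0); rewrite (current_mass_euler q u (leqnn _)).
transitivity (\sum_(k < current_size C) path_sum q (multinomial q) u k.+1 u C).
  apply: eq_bigr => k _; apply: eq_big => [t|t /eqP tu].
    by rewrite tuple_root_last.
  (* Removing a nontrivial loop lowers the size and keeps the current balanced. *)
  rewrite tu; case: ifP => // le; congr (_ * _); apply: IH.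
    rewrite current_size_sub// -tu.
    have := current_size_loop (\pi_(unrooted_loop V) (tuple_loop t)).
    by rewrite edge_count_pi loop_length_pi tuple_loop_length /= => ->; lia.
  move=> a; rewrite -/(outdeg _ _) -/(indeg _ _) outdeg_sub// indeg_sub// out_in.
  by have := path_flow u t a; rewrite tuple_root_last tu => /addIn ->.
have fl : flow C u u by move=> a; rewrite out_in.
have := path_sum_multinomial q fl (leqnn _).
(* The trivial path accounts for the extra 1 in [(outdeg C u).+1]; cancelling it leaves the
   nontrivial loops. *)
rewrite big_ord_recl path_sum0 eqxx mul1r -nat1r mulrDl mul1r out_in.
by move=> /addrI <-; apply: eq_bigr.
Qed.

Lemma multinomialE C : is_current C -> multinomial q C =
  current_weight q C * \prod_u (((current_degree C u)`!)%:R / (\prod_v (C u v)`!)%N%:R).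
Proof.
move=> Cc; rewrite /multinomial /current_weight -big_split; apply: eq_bigr => u _.
rewrite /vertex_weight -mulrA; congr (_ * (_`!%:R / _)).
by rewrite /current_degree big_split/= -Cc addnn doubleK.
Qed.

End CurrentField.

Theorem mainTheorem1 (R : realType) (V : finType) (q : V -> V -> R[i])
    (V_nonempty : (0 < #|V|)%N) (q_integrable : integrable_weight q)
    (C : V -> V -> nat) (C_current : is_current C) :
  current_field q C =
    \det (1%:M - weight_mx q) * current_weight q C *
    \prod_(u : V)
      (((current_degree C u)`!)%:R / (\prod_(v : V) (C u v)`!)%N%:R).
Proof.
have [n e] : exists n, #|V| = n.+1 by exists #|V|.-1; rewrite prednK.
(* Finitely many soups have current [C], so the unordered sum is a finite one and the normalizing
   exponential factors out. *)
rewrite /current_field csum_finite; last exact: finite_soups_with.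
rewrite -mulrA -multinomialE// -current_mass_multinomial// /current_mass mulr_fsumr.
by rewrite -(cexp_loop_mass q_integrable e).
Qed.
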